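(* The Heyting algebra of the pointed Weihrauch degrees of partial multimaps on multi-represented spaces is isomorphic to the poset of $r$-degrees of monotone, inflationary operations on $\Omega$.
   Context: Let $(\mathsf N,\mathbf N,\ast)$ be one of: (i) Kleene's first algebra: $\mathsf N=\mathbf N=\mathbb N$, $e\ast n=\varphi_e(n)$ for the standard indexing of partial computable functions on $\mathbb N$; (ii) Kleene's second algebra: $\mathsf N=\mathbf N=\mathbb N^{\mathbb N}$, $x\ast y=\varphi_x(y)$ for the standard indexing $(\varphi_x)_{x\in\mathbb N^{\mathbb N}}$ of partial continuous functions on Baire space (e.g. $(x\ast y)(n)=x(\langle n,y(0),\dots,y(k-1)\rangle)-1$ for the least $k$ making $x(\cdots)>0$; $x\ast y$ is defined iff such $k$ exists for all $n$); (iii) the Kleene–Vesley algebra: $\mathbf N=\mathbb N^{\mathbb N}$ with $\ast$ as in (ii) and $\mathsf N$ the set of computable elements of $\mathbb N^{\mathbb N}$. A partial function on $\mathbf N$ is computable if for some $e\in\mathsf N$ it agrees with $x\mapsto e\ast x$ on its domain. Pairs are coded in $\mathbf N$ by a standard computable pairing; $\underline 0,\underline 1\in\mathsf N$ are the standard codes of $0,1$ (the numbers, or the constant sequences). A multi-represented space is a set $X$ with a relation $\mathtt x\vdash_X x$ (''$\mathtt x$ is a name of $x$'') between $\mathbf N$ and $X$ such that every $x\in X$ has at least one name (one $\mathtt x$ may name several points). A partial multimap $f$ from $X$ to $Y$ is a partial function from $X$ to $\mathcal P(Y)$ (the value $\emptyset$ is allowed). An extended predicate is a partial function $F$ from $\mathbf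 N\times\Lambda$ to $\mathcal P(\mathbf N)$, $\Lambda$ a nonempty set; write $F(\mathtt x\mid x)$ for $F(\mathtt x,x)$. A partial multimap $f$ from $X$ to $Y$ between multi-represented spaces is regarded as the extended predicate $\theta_f$ with $\Lambda=X$ (any one-point set if $X=\emptyset$), $\mathrm{dom}(\theta_f)=\{(\mathtt x\mid x):\mathtt x\vdash_X x\in\mathrm{dom}(f)\}$ and $\theta_f(\mathtt x\mid x)=\{\mathtt y:\exists y\in f(x)\;\mathtt y\vdash_Y y\}$. For extended predicates $F,G$, $F\leq_{eW}G$ (extended Weihrauch reducible) iff there are partial computable $\varphi_-,\varphi_+$ on $\mathbf N$ such that for all $(\mathtt x\mid x)\in\mathrm{dom}(F)$ there is $\tilde x$ with $(\varphi_-(\mathtt x)\mid\tilde x)\in\mathrm{dom}(G)$ and such that $\varphi_+(\mathtt x,\mathtt y)\in F(\mathtt x\mid x)$ for all $\mathtt y\in G(\varphi_-(\mathtt x)\mid\tilde x)$. For an extended predicate $G$ on $\mathbf N\times\Lambda$, $\mathrm{id}\sqcup G$ is the extended predicate with $(\mathrm{id}\sqcup G)(\langle\underline 0,\mathtt x\rangle\mid p)=\{\mathtt x\}$ for all $\mathtt x\in\mathbf N$, $p\in\Lambda$, and $(\mathrm{id}\sqcup G)(\langle\underline 1,\mathtt x\rangle\mid p)=G(\mathtt x\mid p)$ for $(\mathtt x\mid p)\in\mathrm{dom}(G)$, undefined otherwise. Partial multimaps $f,g$ on multi-represented spaces satisfy: $f$ is pointed Weihrauch reducible to $g$ iff $\theta_f\leq_{eW}\mathrm{id}\sqcup\theta_g$.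 $\Omega=\mathcal P(\mathbf N)$. For $p,q\in\Omega$, $p\to q=\{x\in\mathbf N: x\ast a\text{ is defined and }x\ast a\in q\text{ for all }a\in p\}$. An operation $j\colon\Omega\to\Omega$ is monotone if some $e\in\mathsf N$ belongs to $(p\to q)\to(j(p)\to j(q))$ for all $p,q\in\Omega$, and inflationary if some $e\in\mathsf N$ belongs to $p\to j(p)$ for all $p\in\Omega$. $j\leq_r k$ iff some $e\in\mathsf N$ belongs to $j(p)\to k(p)$ for all $p\in\Omega$. Degrees are equivalence classes of the preorder, with the induced partial order; the Heyting structure is the one determined by the order, and isomorphism means order isomorphism. *)

(* Defs.v *)
From Stdlib Require Import Arith Cantor List Classical FinFun Relation_Definitions.

Set Implicit Arguments.
Unset Strict Implicit.

(** * Partial recursive functions *)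

(** Programs for unary functions, with several arguments packed by the Cantor
    pairing [Cantor.to_nat]. *)
Inductive code : Set :=
| czero | csucc | cleft | cright
| cpair (f g : code)
| ccomp (f g : code)
| cprec (f g : code)
| cmin (f : code).

(** [eval c n m]: program [c] on input [n] halts with output [m].
    - [cprec f g] sends [<a,k>] to [s k], where [s 0 = f a] and
      [s (i+1) = g <a,<i,s i>>];
    - [cmin f] sends [n] to the least [m] with [f <n,m> = 0], [f] being defined
      and positive at all [<n,i>] with [i < m]. *)
Fixpoint eval (c : code) (n m : nat) {struct c} : Prop :=
  match c with
  | czero => m = 0
  | csucc => m = S n
  | cleft => m = fst (of_nat n)
  | cright => m = snd (of_nat n)
  | cpair f g => exists a b, eval f n a /\ eval g n b /\ m = to_nat (a, b)
  | ccomp f g => exists k, eval g n k /\ eval f k m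
  | cprec f g =>
      exists s : nat -> nat,
        eval f (fst (of_nat n)) (s 0) /\
        (forall i, i < snd (of_nat n) ->
           eval g (to_nat (fst (of_nat n), to_nat (i, s i))) (s (S i))) /\
        m = s (snd (of_nat n))
  | cmin f =>
      eval f (to_nat (n, m)) 0 /\
      (forall i, i < m -> exists v, eval f (to_nat (n, i)) (S v))
  end.

(** Goedel numbering; it is a bijection from [code] onto [nat]. *)
Fixpoint index (c : code) : nat :=
  match c with
  | czero => 0
  | csucc => 1
  | cleft => 2
  | cright => 3
  | cpair f g => 4 + 4 * to_nat (index f, index g)
  | ccomp f g => 5 + 4 * to_nat (index f, index g)
  | cprec f g => 6 + 4 * to_nat (index f, index g)
  | cmin f => 7 + 4 * index f
  end.

(** [phi e n m]: the [e]-th partial computable function is defined at [n], with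
    value [m]. *)
Definition phi (e n m : nat) : Prop := exists c, index c = e /\ eval c n m.

Definition computable_seq (x : nat -> nat) : Prop :=
  exists c, forall n, eval c n (x n).

(** * The three algebras *)

(** [app x y z] is "[x * y] is defined and equal to [z]"; [computable] cuts out
    the subalgebra of computable elements, the other fields are the coding of
    pairs and of the numbers 0 and 1. *)
Record algebra : Type := Algebra {
  carrier :> Type;
  computable : carrier -> Prop;
  app : carrier -> carrier -> carrier -> Prop;
  pr : carrier -> carrier -> carrier;
  code0 : carrier;
  code1 : carrier
}.
Arguments computable {a} _.
Arguments app {a} _ _ _.
Arguments pr {a} _ _.
Arguments code0 {a}.
Arguments code1 {a}.

Definition K1 : algebra :=
  {| carrier := nat;
     computable := fun _ => True;
     app := phi;
     pr := fun x y => to_nat (x, y);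
     code0 := 0;
     code1 := 1 |}.

(** A bijection between finite sequences and numbers. *)
Fixpoint seq_code (l : list nat) : nat :=
  match l with
  | nil => 0
  | a :: l => S (to_nat (a, seq_code l))
  end.

(** The code of [(n, y 0, ..., y (k-1))]. *)
Definition query (n : nat) (y : nat -> nat) (k : nat) : nat :=
  seq_code (n :: map y (seq 0 k)).

Definition baire_app (x y z : nat -> nat) : Prop :=
  forall n, exists k,
    x (query n y k) = S (z n) /\ forall i, i < k -> x (query n y i) = 0.

Definition baire_pair (x y : nat -> nat) : nat -> nat :=
  fun n => if Nat.even n then x (Nat.div2 n) else y (Nat.div2 n).

Definition baire_algebra (P : (nat -> nat) -> Prop) : algebra :=
  {| carrier := nat -> nat;
     computable := P;
     app := baire_app;
     pr := baire_pair;
     code0 := fun _ => 0;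
     code1 := fun _ => 1 |}.

Definition K2 : algebra := baire_algebra (fun _ => True).
Definition KV : algebra := baire_algebra computable_seq.

Inductive algebra_name : Set := Kleene_first | Kleene_second | Kleene_Vesley.

Definition algebra_of (a : algebra_name) : algebra :=
  match a with
  | Kleene_first => K1
  | Kleene_second => K2
  | Kleene_Vesley => KV
  end.

(** * Partial functions, multi-represented spaces, extended predicates *)

(** [fn f a] is irrelevant when [a] is not in [dom f]: no definition below
    depends on it. *)
Record pfun (A B : Type) : Type := PFun { dom : A -> Prop; fn : A -> B }.

Definition partial_computable (N : algebra) (f : pfun N N) : Prop :=
  exists e : N, computable e /\ forall x, dom f x -> app e x (fn f x).

Record mrep (N : algebra) : Type := MRep {
  point :> Type;
  names : N -> point -> Prop;
  has_name : forall x, exists n, names n x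
}.
Arguments names {N m} _ _.

Record multimap (N : algebra) : Type := Multimap {
  source : mrep N;
  target : mrep N;
  mmap :> pfun source (target -> Prop)
}.

Record epred (N : algebra) : Type := EPred {
  param : Type;
  param_inhabited : inhabited param;
  efun :> pfun (N * param) (N -> Prop)
}.

(** [epred_le F G] is [F <=_eW G]. *)
Definition epred_le (N : algebra) (F G : epred N) : Prop :=
  exists phi_minus phi_plus : pfun N N,
    partial_computable phi_minus /\ partial_computable phi_plus /\
    forall (x : N) (p : param F), dom F (x, p) ->
      dom phi_minus x /\
      exists q : param G,
        dom G (fn phi_minus x, q) /\
        forall y, fn G (fn phi_minus x, q) y ->
          dom phi_plus (pr x y) /\ fn F (x, p) (fn phi_plus (pr x y)).

(** [X + {~ inhabited X}] is [X] if [X] is nonempty and a one-point set if [X]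
    is empty. *)
Lemma theta_param_inhabited (X : Type) : inhabited (X + {~ inhabited X}).
Proof.
destruct (classic (inhabited X)) as [[x]|h].
- exact (inhabits (inleft x)).
- exact (inhabits (inright h)).
Qed.

Definition theta (N : algebra) (f : multimap N) : epred N :=
  @EPred N (source f + {~ inhabited (source f)})
    (theta_param_inhabited (source f))
    (PFun
       (fun xp => match snd xp with
                  | inleft p => names (fst xp) p /\ dom f p
                  | inright _ => False
                  end)
       (fun xp y => match snd xp with
                    | inleft p => exists v, fn f p v /\ names y v
                    | inright _ => False
                    end)).

Definition id_join (N : algebra) (G : epred N) : epred N :=
  @EPred N (param G) (param_inhabited G)
    (PFun
       (fun zp => (exists x, fst zp = pr code0 x) \/
                  (exists x, fst zp = pr code1 x /\ dom G (x, snd zp)))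
       (fun zp y => fst zp = pr code0 y \/
                    (exists x, fst zp = pr code1 x /\ dom G (x, snd zp) /\
                               fn G (x, snd zp) y))).

(** Pointed Weihrauch reducibility. *)
Definition pW_le (N : algebra) (f g : multimap N) : Prop :=
  epred_le (theta f) (id_join (theta g)).

(** * Operations on the powerset *)

Definition Omega (N : algebra) : Type := N -> Prop.

Definition arrow (N : algebra) (p q : Omega N) : Omega N :=
  fun x => forall a, p a -> exists b, app x a b /\ q b.

Definition monotone (N : algebra) (j : Omega N -> Omega N) : Prop :=
  exists e : N, computable e /\
    forall p q, arrow (arrow p q) (arrow (j p) (j q)) e.

Definition inflationary (N : algebra) (j : Omega N -> Omega N) : Prop :=
  exists e : N, computable e /\ forall p, arrow p (j p) e.

Definition operation (N : algebra) : Type :=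
  {j : Omega N -> Omega N | monotone j /\ inflationary j}.

Definition r_le (N : algebra) (j k : operation N) : Prop :=
  exists e : N, computable e /\
    forall p, arrow (proj1_sig j p) (proj1_sig k p) e.

(** * Degrees and order-theoretic notions *)

(** The equivalence classes of [fun x y => le x y /\ le y x]. *)
Record degree (T : Type) (le : relation T) : Type := Degree {
  class : T -> Prop;
  class_spec : exists x, class = (fun y => le x y /\ le y x)
}.

Definition degree_le (T : Type) (le : relation T) : relation (degree le) :=
  fun c d => exists x y, class c x /\ class d y /\ le x y.
Arguments degree_le {T} le _ _.

Definition heyting_algebra (T : Type) (le : relation T) : Prop :=
  order T le /\
  exists (bot top : T) (meet join imp : T -> T -> T),
    (forall a, le bot a) /\
    (forall a, le a top) /\
    (forall a b c, le c (meet a b) <-> le c a /\ le c b) /\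
    (forall a b c, le (join a b) c <-> le a c /\ le b c) /\
    (forall a b c, le c (imp a b) <-> le (meet c a) b).

Definition order_isomorphic (S T : Type) (leS : relation S) (leT : relation T) :
    Prop :=
  exists f : S -> T,
    Bijective f /\ forall a b, leS a b <-> leT (f a) (f b).

(* Main.v *)
(** A multimap [f] gives the operation [p => p \/ O_f(p)], where [O_f(p)] is the
    union, over the instances [(x | l)] of [f], of [{x} /\ (f(x | l) -> p)]; here
    the connectives are those of the realizability tripos, in which uniformly
    realized implication is entailment. A pointed reduction of [f] to [g] says
    precisely that [{x}] entails [f(x | l) \/ O_g(f(x | l))] uniformly in
    the instance, and, by monotonicity of the right-hand side, that [O_f] entails
    [id \/ O_g]. Conversely, a monotone inflationary [j] is recovered from the
    multimap whose instances are the [(x | p)] with [x] in [j(p)], with answer [p].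
    The Heyting structure is computed on operations, the implication of [j] and
    [k] being [p => forall q, (p -> q) -> (j q -> k q)].

    This uses only a few closure properties of the algebra. For Kleene's first
    algebra they follow from a universal program, a stack machine; for the other
    two, from the fact that a code of a continuous function is itself a table of
    approximations, so that codes can be written down explicitly. *)

From Stdlib Require Import ClassicalEpsilon FunctionalExtensionality PropExtensionality.
From Stdlib Require Import Arith Cantor List Lia FinFun Relation_Definitions.
Require Import Defs.

Set Implicit Arguments.
Unset Strict Implicit.

(** * Entailment *)

(** [share_ex] is the rule of the combinator S. *)
Record combinatory (N : algebra) : Prop := Combinatory {
  app_functional : forall x y z z' : N, app x y z -> app x y z' -> z = z';
  code0_computable : computable (@code0 N);
  code1_computable : computable (@code1 N);
  code0_neq_code1 : @code0 N <> code1;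
  const_ex : forall a : N, computable a ->
    exists k : N, computable k /\ forall x, app k x a;
  share_ex : forall d e : N, computable d -> computable e ->
    exists f : N, computable f /\
      forall x u v w, app d x u -> app e x v -> app u v w -> app f x w;
  pairing_ex : forall d e : N, computable d -> computable e ->
    exists f : N, computable f /\
      forall x u v, app d x u -> app e x v -> app f x (pr u v);
  fst_ex : exists f : N, computable f /\ forall x y, app f (pr x y) x;
  snd_ex : exists f : N, computable f /\ forall x y, app f (pr x y) y;
  curry_ex : forall e : N, computable e ->
    exists f : N, computable f /\ forall x, exists g, app f x g /\
      forall y z, app e (pr x y) z -> app g y z;
  select_ex : forall a b : N, computable a -> computable b ->
    exists f : N, computable f /\
      (forall x, app f (pr code0 x) a) /\ (forall x, app f (pr code1 x) b)
}.

Section Entailment.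

Variable N : algebra.
Hypothesis HN : combinatory N.

(** The identity arises as S K K does: currying the first projection gives K, and S is applied to it
    and a constant. *)
Lemma id_ex : exists e : N, computable e /\ forall x, app e x x.
Proof.
destruct (fst_ex HN) as [p [hp ep]].
destruct (curry_ex HN hp) as [k [hk ek]].
destruct (const_ex HN (code0_computable HN)) as [c [hc ec]].
destruct (share_ex HN hk hc) as [i [hi ei]].
exists i; split; [exact hi|]; intro x.
destruct (ek x) as [g [hg eg]].
exact (ei _ _ _ _ hg (ec x) (eg _ _ (ep _ _))).
Qed.

Lemma compose_ex (d e : N) : computable d -> computable e ->
  exists f : N, computable f /\
    forall x y z, app d x y -> app e y z -> app f x z.
Proof.
intros hd he.
destruct (const_ex HN he) as [c [hc ec]].
destruct (share_ex HN hc hd) as [f [hf ef]].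
exists f; split; [exact hf|]; intros x y z h1 h2.
exact (ef _ _ _ _ (ec x) h1 h2).
Qed.

Lemma pr_inj (x y x' y' : N) : pr x y = pr x' y' -> x = x' /\ y = y'.
Proof.
intro h.
destruct (fst_ex HN) as [f [_ ef]]; destruct (snd_ex HN) as [s [_ es]].
split.
- apply (app_functional HN (ef x y)); rewrite h; apply ef.
- apply (app_functional HN (es x y)); rewrite h; apply es.
Qed.

(** * Connectives and rules of the realizability tripos *)

Definition pconj (p q : Omega N) : Omega N :=
  fun z => exists x y, z = pr x y /\ p x /\ q y.

Definition pdisj (p q : Omega N) : Omega N :=
  fun z => (exists x, z = pr code0 x /\ p x) \/
           (exists y, z = pr code1 y /\ q y).

Definition punion (U : Type) (p : U -> Omega N) : Omega N :=
  fun z => exists u, p u z.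

Definition pinter (U : Type) (p : U -> Omega N) : Omega N :=
  fun z => forall u, p u z.

Definition entails (I : Type) (P Q : I -> Omega N) : Prop :=
  exists e : N, computable e /\ forall i, arrow (P i) (Q i) e.

Section Rules.

Variable I : Type.
Implicit Types P Q R : I -> Omega N.

Lemma entails_sub P Q : (forall i x, P i x -> Q i x) -> entails P Q.
Proof.
intro h; destruct id_ex as [e [he ee]].
exists e; split; [exact he|]; intros i a ha; exists a; auto.
Qed.

Lemma entails_refl P : entails P P.
Proof. apply entails_sub; auto. Qed.

Lemma entails_trans P Q R : entails P Q -> entails Q R -> entails P R.
Proof.
intros [d [hd ed]] [e [he ee]].
destruct (compose_ex hd he) as [f [hf ef]].
exists f; split; [exact hf|]; intros i a ha.
destruct (ed i a ha) as [b [hb qb]]; destruct (ee i b qb) as [c [hc rc]].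
exists c; split; [exact (ef _ _ _ hb hc)|exact rc].
Qed.

Lemma entails_reindex (K : Type) (P' Q' : K -> Omega N) (f : I -> K) :
  entails P' Q' -> entails (fun i => P' (f i)) (fun i => Q' (f i)).
Proof. intros [e [he ee]]; exists e; split; [exact he|intro i; apply ee]. Qed.

Lemma entails_cut (K : Type) (P' Q' : K -> Omega N) (f : I -> K) P :
  entails P' Q' -> entails P (fun i => P' (f i)) ->
  entails P (fun i => Q' (f i)).
Proof.
intros h h'; exact (entails_trans h' (entails_reindex f h)).
Qed.

Lemma entails_fst P Q : entails (fun i => pconj (P i) (Q i)) P.
Proof.
destruct (fst_ex HN) as [e [he ee]].
exists e; split; [exact he|]; intros i a [x [y [-> [hx hy]]]]; eauto.
Qed.

Lemma entails_snd P Q : entails (fun i => pconj (P i) (Q i)) Q.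
Proof.
destruct (snd_ex HN) as [e [he ee]].
exists e; split; [exact he|]; intros i a [x [y [-> [hx hy]]]]; eauto.
Qed.

Lemma entails_pair P Q R :
  entails P Q -> entails P R -> entails P (fun i => pconj (Q i) (R i)).
Proof.
intros [d [hd ed]] [e [he ee]].
destruct (pairing_ex HN hd he) as [f [hf ef]].
exists f; split; [exact hf|]; intros i a ha.
destruct (ed i a ha) as [b [hb qb]]; destruct (ee i a ha) as [c [hc rc]].
exists (pr b c); split; [exact (ef _ _ _ hb hc)|exists b, c; auto].
Qed.

Lemma entails_curry P Q R :
  entails (fun i => pconj (P i) (Q i)) R ->
  entails P (fun i => arrow (Q i) (R i)).
Proof.
intros [e [he ee]].
destruct (curry_ex HN he) as [f [hf ef]].
exists f; split; [exact hf|]; intros i a ha.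
destruct (ef a) as [g [hg eg]]; exists g; split; [exact hg|]; intros b hb.
destruct (ee i (pr a b)) as [c [hc rc]]; [exists a, b; auto|].
exists c; auto.
Qed.

Lemma entails_mp P Q R :
  entails P (fun i => arrow (Q i) (R i)) -> entails P Q -> entails P R.
Proof.
intros [d [hd ed]] [e [he ee]].
destruct (share_ex HN hd he) as [f [hf ef]].
exists f; split; [exact hf|]; intros i a ha.
destruct (ed i a ha) as [b [hb qb]]; destruct (ee i a ha) as [c [hc rc]].
destruct (qb c rc) as [r [hr rr]].
exists r; split; [exact (ef _ _ _ _ hb hc hr)|exact rr].
Qed.

Lemma entails_inl P Q R :
  entails P Q -> entails P (fun i => pdisj (Q i) (R i)).
Proof.
intro h; apply (entails_trans h).
destruct (const_ex HN (code0_computable HN)) as [c [hc ec]].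
destruct id_ex as [d [hd ed]].
destruct (pairing_ex HN hc hd) as [f [hf ef]].
exists f; split; [exact hf|]; intros i a ha.
exists (pr code0 a); split; [auto|left; eauto].
Qed.

Lemma entails_inr P Q R :
  entails P R -> entails P (fun i => pdisj (Q i) (R i)).
Proof.
intro h; apply (entails_trans h).
destruct (const_ex HN (code1_computable HN)) as [c [hc ec]].
destruct id_ex as [d [hd ed]].
destruct (pairing_ex HN hc hd) as [f [hf ef]].
exists f; split; [exact hf|]; intros i a ha.
exists (pr code1 a); split; [auto|right; eauto].
Qed.

(** The tag selects one of the two realizers, which the combinator S then applies to the second
    component. *)
Lemma entails_disj P Q R :
  entails P R -> entails Q R -> entails (fun i => pdisj (P i) (Q i)) R.
Proof.
intros [d [hd ed]] [e [he ee]].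
destruct (select_ex HN hd he) as [s [hs [es0 es1]]].
destruct (snd_ex HN) as [t [ht et]].
destruct (share_ex HN hs ht) as [f [hf ef]].
exists f; split; [exact hf|]; intros i a [[x [-> hx]]|[x [-> hx]]].
- destruct (ed i x hx) as [b [hb qb]]; exists b; eauto.
- destruct (ee i x hx) as [b [hb qb]]; exists b; eauto.
Qed.

Lemma entails_union (U : Type) (P : I -> U -> Omega N) Q :
  entails (fun iu => P (fst iu) (snd iu)) (fun iu : I * U => Q (fst iu)) ->
  entails (fun i => punion (P i)) Q.
Proof.
intros [e [he ee]]; exists e; split; [exact he|].
intros i a [u hu]; exact (ee (i, u) a hu).
Qed.

(** All [u] share one output because application is single-valued. A point of [U] guarantees that
    there is an output: over an empty [U] the intersection is the whole algebra, but a realizer must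
    still be defined on [P]. *)
Lemma entails_inter (U : Type) P (Q : I -> U -> Omega N) : inhabited U ->
  entails (fun iu : I * U => P (fst iu)) (fun iu => Q (fst iu) (snd iu)) ->
  entails P (fun i => pinter (Q i)).
Proof.
intros [u0] [e [he ee]]; exists e; split; [exact he|].
intros i a ha; destruct (ee (i, u0) a ha) as [b [hb _]].
exists b; split; [exact hb|]; intro u.
destruct (ee (i, u) a ha) as [c [hc qc]].
now rewrite (app_functional HN hb hc).
Qed.

Lemma entails_inter_elim (U : Type) P (Q : I -> U -> Omega N) (f : I -> U) :
  entails P (fun i => pinter (Q i)) -> entails P (fun i => Q i (f i)).
Proof.
intro h; apply (entails_trans h); apply entails_sub; intros i x hx; apply hx.
Qed.

End Rules.

Lemma entails_union_conj (I U : Type) (P Q : I -> Omega N)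
    (R : I -> U -> Omega N) :
  entails (fun iu => pconj (P (fst iu)) (R (fst iu) (snd iu)))
          (fun iu : I * U => Q (fst iu)) ->
  entails (fun i => pconj (P i) (punion (R i))) Q.
Proof.
intros [e [he ee]]; exists e; split; [exact he|].
intros i a [x [y [-> [hx [u hu]]]]].
apply (ee (i, u)); exists x, y; auto.
Qed.

(** Distributivity comes from implication: each disjunct entails [arrow P S], hence so does the
    disjunction. *)
Lemma entails_disj_conj (I : Type) (P Q R S : I -> Omega N) :
  entails (fun i => pconj (P i) (Q i)) S ->
  entails (fun i => pconj (P i) (R i)) S ->
  entails (fun i => pconj (P i) (pdisj (Q i) (R i))) S.
Proof.
intros h1 h2.
assert (swap : forall T : I -> Omega N, entails (fun i => pconj (P i) (T i)) S ->
  entails T (fun i => arrow (P i) (S i))).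
{ intros T h; apply entails_curry.
  eapply entails_trans; [|exact h].
  apply entails_pair; [apply entails_snd|apply entails_fst]. }
eapply entails_mp; [|apply entails_fst].
eapply entails_trans; [apply entails_snd|].
apply entails_disj; auto.
Qed.

End Entailment.

(** Closes a goal whose conclusion is a component of a nested conjunction, by trying all paths of
    projections. *)
Ltac project :=
  match goal with HN : combinatory _ |- _ =>
    solve [ apply (entails_refl HN)
          | eapply (entails_trans HN); [apply (entails_fst HN)|project]
          | eapply (entails_trans HN); [apply (entails_snd HN)|project] ]
  end.

(** * Operations and multimaps *)

Section Operations.

Variable N : algebra.
Hypothesis HN : combinatory N.
Implicit Types j k : Omega N -> Omega N.

Section Use.

Variables (I : Type) (P p q : I -> Omega N).

(** The internal form of monotonicity: the implication from [p] to [q] may depend on the context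
    [P], since monotonicity is realized on realizers of implications. *)
Lemma monotone_use j : monotone j ->
  entails P (fun i => arrow (p i) (q i)) ->
  entails P (fun i => j (p i)) -> entails P (fun i => j (q i)).
Proof.
intros [e [he ee]] h; apply (entails_mp HN).
apply (entails_trans HN h).
exists e; split; [exact he|intro i; apply ee].
Qed.

Lemma inflationary_use j : inflationary j ->
  entails P p -> entails P (fun i => j (p i)).
Proof.
intros [e [he ee]] h; apply (entails_trans HN h).
exists e; split; [exact he|intro i; apply ee].
Qed.

End Use.

Lemma monotone_intro j :
  entails (fun pq => pconj (arrow (fst pq) (snd pq)) (j (fst pq)))
          (fun pq : Omega N * Omega N => j (snd pq)) ->
  monotone j.
Proof.
intro h; destruct (entails_curry HN h) as [e [he ee]].
exists e; split; [exact he|intros p q; exact (ee (p, q))].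
Qed.

(** * Oracle operations and reducibility *)

Definition instance (F : epred N) : Type := {xl : N * param F | dom F xl}.

Definition input (F : epred N) (u : instance F) : Omega N :=
  eq (fst (proj1_sig u)).

Definition output (F : epred N) (u : instance F) : Omega N :=
  fn F (proj1_sig u).

Definition oracle (F : epred N) (p : Omega N) : Omega N :=
  punion (fun u => pconj (@input F u) (arrow (output u) p)).

Lemma oracle_monotone (F : epred N) : monotone (oracle F).
Proof.
apply monotone_intro; unfold oracle.
apply entails_union_conj.
apply (@entails_trans _ HN) with
  (fun i : (Omega N * Omega N) * instance F =>
     pconj (input (snd i)) (arrow (output (snd i)) (snd (fst i)))).
2: apply (entails_sub HN); intros i x hx; exists (snd i); exact hx.
apply (entails_pair HN); [project|].
apply (entails_curry HN).
eapply (entails_mp HN); [project|].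
eapply (entails_mp HN); project.
Qed.

(** Among the monotone operations that answer all instances of [F], [oracle F] is thus the least. To
    answer an instance by [oracle F] itself, the continuation is the identity on the answer set. *)
Lemma entails_oracle (F : epred N) j : monotone j ->
  entails (@input F) (fun u => j (output u)) <-> entails (oracle F) j.
Proof.
intro mj; split; intro h.
- unfold oracle; apply (entails_union (U := instance F)).
  apply (@monotone_use _ _ (fun iu => output (snd iu)) _ _ mj); [project|].
  apply (@entails_cut _ HN _ _ _ _ snd _ h); project.
- apply (@entails_cut _ HN _ _ _ _ (@output F) _ h).
  apply (@entails_trans _ HN _ _
           (fun u => pconj (input u) (arrow (output u) (output u)))).
  2: apply (entails_sub HN); intros u x hx; exists u; exact hx.
  apply (entails_pair HN); [project|apply (entails_curry HN); project].
Qed.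

(** A realizer of the entailment sends a name [x] to the query put to [G], paired with a code of the
    function that turns an answer [y] into an answer for [x]. Currying and uncurrying [phi_plus]
    pass between the two forms. *)
Lemma epred_le_entails (F G : epred N) :
  epred_le F G <-> entails (@input F) (fun u => oracle G (output u)).
Proof.
split.
- intros [m [q [[d [hd ed]] [[e [he ee]] h]]]].
  destruct (curry_ex HN he) as [c [hc ec]].
  destruct (pairing_ex HN hd hc) as [f [hf ef]].
  exists f; split; [exact hf|]; intros [[x p] hu] a ha; unfold input in ha; cbn in ha; subst a.
  destruct (h x p hu) as [hm [l [hl hy]]].
  destruct (ec x) as [g [hg eg]].
  exists (pr (fn m x) g); split; [exact (ef _ _ _ (ed x hm) hg)|].
  exists (exist _ (fn m x, l) hl).
  exists (fn m x), g; split; [reflexivity|split; [reflexivity|]].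
  intros y gy; destruct (hy y gy) as [h1 h2].
  exists (fn q (pr x y)); split; [exact (eg _ _ (ee _ h1))|exact h2].
- intro h.
  assert (h1 := h); destruct h1 as [e [he ee]].
  destruct (fst_ex HN) as [p1 [hp1 ep1]]; destruct (snd_ex HN) as [p2 [hp2 ep2]].
  destruct (compose_ex HN he hp1) as [d [hd ed]].
  destruct (compose_ex HN he hp2) as [c [hc ec]].
  destruct (compose_ex HN hp1 hc) as [c' [hc' ec']].
  destruct (share_ex HN hc' hp2) as [r [hr er]].
  (* Application is a relation, whereas [pfun] wants a total [fn]: choice picks the value, arbitrary
     outside the domain. *)
  assert (ch : forall t : N, exists m : pfun N N,
    (forall x, dom m x -> app t x (fn m x)) /\
    forall x z, app t x z -> dom m x /\ fn m x = z).
  { intro t.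
    exists (PFun (fun x => exists z, app t x z)
                 (fun x => epsilon (inhabits (@code0 N)) (app t x))).
    assert (w : forall x, (exists z, app t x z) ->
      app t x (epsilon (inhabits (@code0 N)) (app t x)))
      by (intro x; apply epsilon_spec).
    split; cbn; [exact w|].
    intros x z hz; split; [eauto|].
    apply (@app_functional _ HN t x); [apply w; eauto|exact hz]. }
  destruct (ch d) as [m [em um]]; destruct (ch r) as [q [eq uq]].
  exists m, q; split; [exists d; auto|split; [exists r; auto|]].
  intros x p hp.
  destruct (ee (exist _ (x, p) hp) x eq_refl) as
    [b [hb [[[x' l] hl] [y [g [-> [hy hg]]]]]]].
  unfold input in hy; cbn in hy; subst y; unfold output in hg; cbn in hg.
  destruct (um x x' (ed _ _ _ hb (ep1 _ _))) as [h1 ->]; split; [exact h1|].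
  exists l; split; [exact hl|]; intros y gy.
  destruct (hg y gy) as [z [hz fz]].
  assert (h2 : app r (pr x y) z).
  { eapply er; [|apply ep2|exact hz].
    eapply ec'; [apply ep1|]; eapply ec; [exact hb|apply ep2]. }
  destruct (uq _ _ h2) as [h3 ->]; split; assumption.
Qed.

Lemma oracle_id_join (G : epred N) :
  entails (oracle (id_join G)) (fun p => pdisj p (oracle G p)) /\
  entails (fun p => pdisj p (oracle G p)) (oracle (id_join G)).
Proof.
split.
- unfold oracle at 1; apply (entails_union (U := instance (id_join G))).
  (* The tag is moved from the input into a disjunction, whose two sides hold the untagged inputs;
     what remains is a case distinction inside the tripos. *)
  apply (@entails_trans _ HN _ _ (fun iu : Omega N * instance (id_join G) =>
    pconj (arrow (output (snd iu)) (fst iu))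
      (pdisj (fun x => fst (proj1_sig (snd iu)) = pr code0 x)
            (fun x => fst (proj1_sig (snd iu)) = pr code1 x /\
                      dom G (x, snd (proj1_sig (snd iu))))))).
  + apply (entails_pair HN); [project|].
    eapply (entails_trans HN); [apply (entails_fst HN)|].
    apply (entails_sub HN); intros [p [[z l] hz]] x hx.
    unfold input in hx; cbn in *; subst x.
    destruct hz as [[x hx]|[x [hx h]]]; [left|right]; exists x; auto.
  + apply (entails_disj_conj HN).
    * apply (entails_inl HN); eapply (entails_mp HN); [project|].
      eapply (entails_trans HN); [apply (entails_snd HN)|].
      apply (entails_sub HN); intros [p [[z l] hz]] x hx; left; exact hx.
    * apply (entails_inr HN).
      apply (@entails_trans _ HN _ _ (fun iu : Omega N * instance (id_join G) =>
        pconj (fun x => fst (proj1_sig (snd iu)) = pr code1 x /\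
                       dom G (x, snd (proj1_sig (snd iu))))
             (arrow (output (snd iu)) (fst iu)))).
      { apply (entails_pair HN); project. }
      apply (entails_sub HN).
      intros [p [[z l] hz]] w [x [d [-> [[hx h] hd]]]]; cbn in *; subst z.
      exists (exist _ (x, l) h), x, d; repeat split; intros y hy.
      apply hd; right; exists x; auto.
- apply (entails_disj HN).
  (* Disjunction with the empty set merely attaches the tag. The continuation is constant, so it may
     be taken to accept every answer. *)
  + apply (@entails_trans _ HN _ _ (fun p =>
      pconj (pdisj p (fun _ => False)) (arrow (fun _ => True) p))).
    * apply (entails_pair HN).
      -- apply (entails_inl HN); apply (entails_refl HN).
      -- apply (entails_curry HN); project.
    * apply (entails_sub HN).
      intros p w [z [d [-> [[[x [-> hx]]|[x [_ []]]] hd]]]].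
      (* Even an instance of the identity carries a parameter of [G]. *)
      destruct (param_inhabited G) as [l].
      assert (h : dom (id_join G) (pr code0 x, l)) by (left; exists x; auto).
      exists (exist _ _ h), (pr code0 x), d; repeat split.
      intros y _; apply hd; exact Logic.I.
  + unfold oracle at 1; apply (entails_union (U := instance G)).
    apply (@entails_trans _ HN _ _ (fun iu : Omega N * instance G =>
      pconj (pdisj (fun _ => False) (input (snd iu)))
           (arrow (output (snd iu)) (fst iu)))).
    * apply (entails_pair HN); [|project].
      apply (entails_inr HN); project.
    * apply (entails_sub HN).
      intros [p [[x l] hu]] w [z [d [-> [[[y [_ []]]|[y [-> hy]]] hd]]]].
      unfold input in hy; cbn in hy; subst y.
      assert (h : dom (id_join G) (pr code1 x, l)) by (right; exists x; auto).
      exists (exist _ _ h), (pr code1 x), d; repeat split.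
      intros y [hy|[x' [hx' [_ hy]]]]; cbn in *.
      (* An answer from the identity side would force the two tags to coincide. *)
      -- destruct (pr_inj HN hy) as [e _]; now destruct (code0_neq_code1 HN).
      -- destruct (pr_inj HN hx') as [_ <-]; apply hd; exact hy.
Qed.

(** The identity entails every inflationary operation, so the disjunct [p] costs nothing. *)
Lemma entails_disj_inflationary (j k : Omega N -> Omega N) : inflationary k ->
  entails (fun p => pdisj p (j p)) k <-> entails j k.
Proof.
intro ik; split; intro h.
- apply (@entails_trans _ HN _ _ (fun p => pdisj p (j p))); [|exact h].
  apply (entails_inr HN); apply (entails_refl HN).
- apply (entails_disj HN); [|exact h].
  apply (inflationary_use ik); apply (entails_refl HN).
Qed.

Lemma inflationary_intro j : entails (fun p => p) j -> inflationary j.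
Proof. auto. Qed.

Lemma disj_monotone j k : monotone j -> monotone k ->
  monotone (fun p => pdisj (j p) (k p)).
Proof.
intros mj mk; apply monotone_intro; apply (entails_disj_conj HN).
- apply (entails_inl HN).
  apply (@monotone_use _ _ (fun pq => fst pq) _ _ mj); project.
- apply (entails_inr HN).
  apply (@monotone_use _ _ (fun pq => fst pq) _ _ mk); project.
Qed.

Lemma id_monotone : monotone (fun p : Omega N => p).
Proof. apply monotone_intro; eapply (entails_mp HN); project. Qed.

Definition operation_of (f : multimap N) : operation N.
Proof.
exists (fun p => pdisj p (oracle (theta f) p)); split.
- apply (disj_monotone id_monotone); apply oracle_monotone.
- apply inflationary_intro; apply (entails_inl HN); apply (entails_refl HN).
Defined.

Lemma r_le_entails (j k : operation N) :
  r_le j k <-> entails (proj1_sig j) (proj1_sig k).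
Proof. reflexivity. Qed.

(** Both sides reduce to the entailment from [oracle (theta f)] to [id \/ oracle (theta g)]: the
    left one through leastness of oracles and [oracle_id_join], the right one by dropping the
    identity disjunct. *)
Lemma operation_of_le (f g : multimap N) :
  pW_le f g <-> r_le (operation_of f) (operation_of g).
Proof.
rewrite r_le_entails.
change (proj1_sig (operation_of f)) with (fun p => pdisj p (oracle (theta f) p)).
rewrite (entails_disj_inflationary _ (proj2 (proj2_sig (operation_of g)))).
unfold pW_le; rewrite epred_le_entails.
rewrite (@entails_oracle _ (fun p => oracle (id_join (theta g)) p)) by apply oracle_monotone.
destruct (oracle_id_join (theta g)) as [h1 h2].
split; intro h; apply (entails_trans HN h); assumption.
Qed.

(** The points are the [q] with [j q] inhabited, the names of [q] are the elements
    of [j q], and the multimap sends [q] to [q] as a subset of the algebra. *)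
Definition multimap_of (j : Omega N -> Omega N) : multimap N :=
  {| source := MRep (names := fun x (q : {q | exists x, j q x}) => j (proj1_sig q) x)
                    (fun q => proj2_sig q);
     target := MRep (names := @eq N) (fun x => ex_intro _ x eq_refl);
     mmap := PFun (fun _ => True) (fun q => proj1_sig q) |}.

Lemma operation_of_multimap_of (j : operation N) :
  r_le (operation_of (multimap_of (proj1_sig j))) j /\
  r_le j (operation_of (multimap_of (proj1_sig j))).
Proof.
destruct j as [j [mj ij]]; unfold r_le; cbn; split.
- change (entails (fun p => pdisj p (oracle (theta (multimap_of j)) p)) j).
  rewrite entails_disj_inflationary by exact ij.
  apply entails_oracle; [exact mj|].
  apply (entails_sub HN); intros [[x [[q hq]|n]] hu] y hy; [|destruct hu].
  unfold input in hy; cbn in hy; subst y.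
  (* The answer set collects the names of the points of [q]; each point is its own only name, so
     this is [q], but only extensionally. *)
  match goal with |- j (output ?u) x => replace (output u) with q end; [exact (proj1 hu)|].
  apply functional_extensionality; intro y; apply propositional_extensionality.
  unfold output; cbn; split; [intro h; exists y; auto|intros [v [h ->]]; exact h].
- change (entails j (fun p => pdisj p (oracle (theta (multimap_of j)) p))).
  apply (entails_inr HN).
  apply (@entails_trans _ HN _ _ (fun p => pconj (j p) (arrow p p))).
  + apply (entails_pair HN); [project|apply (entails_curry HN); project].
  + apply (entails_sub HN); intros p w [x [d [-> [hx hd]]]].
    set (q := exist (fun q => exists x, j q x) p (ex_intro _ x hx)).
    assert (h : dom (theta (multimap_of j)) (x, inleft q)) by (cbn; auto).
    exists (exist _ _ h), x, d; repeat split.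
    intros y [v [hv ->]]; apply hd; exact hv.
Qed.

(** Heyting structure up to equivalence, so that it can be computed on operations and multimaps
    before passing to degrees. *)
Definition preheyting (T : Type) (le : relation T) : Prop :=
  preorder T le /\
  exists (bot top : T) (meet join imp : T -> T -> T),
    (forall a, le bot a) /\
    (forall a, le a top) /\
    (forall a b c, le c (meet a b) <-> le c a /\ le c b) /\
    (forall a b c, le (join a b) c <-> le a c /\ le b c) /\
    (forall a b c, le c (imp a b) <-> le (meet c a) b).

Lemma r_le_preheyting : preheyting (@r_le N).
Proof.
assert (inh : inhabited (Omega N)) by (constructor; exact (fun _ => True)).
split; [split|].
- intro j; apply (entails_refl HN).
- intros j k l; apply (entails_trans HN).
- unshelve eexists (exist _ (fun p => p) _).
  { split; [apply id_monotone|apply inflationary_intro, (entails_refl HN)]. }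
  unshelve eexists (exist _ (fun p _ => True) _).
  { split.
    - apply monotone_intro; apply (entails_sub HN); auto.
    - apply inflationary_intro, (entails_sub HN); auto. }
  unshelve eexists (fun j k : operation N => exist _ (fun p => pconj (proj1_sig j p) (proj1_sig k p)) _).
  { destruct j as [j [mj ij]], k as [k [mk ik]]; cbn; split.
    - apply monotone_intro; apply (entails_pair HN).
      + apply (@monotone_use _ _ (fun pq => fst pq) _ _ mj); project.
      + apply (@monotone_use _ _ (fun pq => fst pq) _ _ mk); project.
    - apply inflationary_intro; apply (entails_pair HN); assumption. }
  unshelve eexists (fun j k : operation N => exist _ (fun p => pdisj (proj1_sig j p) (proj1_sig k p)) _).
  { destruct j as [j [mj ij]], k as [k [mk ik]]; cbn; split.
    - apply disj_monotone; assumption.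
    - apply inflationary_intro; apply (entails_inl HN); assumption. }
  unshelve eexists (fun j k : operation N => exist _ (fun p => pinter (fun q : Omega N =>
    arrow (arrow p q) (arrow (proj1_sig j q) (proj1_sig k q)))) _).
  { destruct j as [j [mj ij]], k as [k [mk ik]]; cbn; split.
    - apply monotone_intro; apply (entails_inter HN (U := Omega N)); [exact inh|].
      do 2 apply (entails_curry HN).
      (* To pass from the first set to the second, the intersection is used at the same [q], after
         composing the given implications into one from the first set to [q]. *)
      apply (@entails_mp _ HN _ _ (fun iu => j (snd iu))); [|project].
      apply (@entails_mp _ HN _ _ (fun iu => arrow (fst (fst iu)) (snd iu))).
      + apply (@entails_inter_elim _ HN _ _ _ (fun iu q =>
          arrow (arrow (fst (fst iu)) q) (arrow (j q) (k q))) snd); project.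
      + apply (entails_curry HN); cbn.
        eapply (entails_mp HN); [project|].
        eapply (entails_mp HN); project.
    - apply inflationary_intro; apply (entails_inter HN (U := Omega N)); [exact inh|].
      do 2 apply (entails_curry HN).
      apply (@inflationary_use _ _ (fun iu => snd iu) _ ik).
      eapply (entails_mp HN); project. }
  split; [|split; [|split; [|split]]].
  + intros [j [mj ij]]; exact ij.
  + intro j; apply (entails_sub HN); intros; exact Logic.I.
  + intros j k l; split.
    * intro h; split; eapply (entails_trans HN); [exact h|apply (entails_fst HN)|exact h|apply (entails_snd HN)].
    * intros [h1 h2]; apply (entails_pair HN); assumption.
  + intros j k l; split.
    * intro h; split; eapply (entails_trans HN).
      2,4: exact h.
      -- apply (entails_inl HN), (entails_refl HN).
      -- apply (entails_inr HN), (entails_refl HN).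
    * intros [h1 h2]; apply (entails_disj HN); assumption.
  + intros [j [mj ij]] [k [mk ik]] [l [ml il]]; unfold r_le; cbn; split.
    * intro h.
      change (entails (fun p => pconj (l p) (j p)) k).
      apply (@entails_mp _ HN _ _ j); [|project].
      (* The intersection is instantiated at [q = p], with the identity as the implication. *)
      apply (@entails_mp _ HN _ _ (fun p => arrow p p)).
      -- apply (@entails_inter_elim _ HN _ _ _ (fun p q =>
           arrow (arrow p q) (arrow (j q) (k q))) (fun p => p)).
         eapply (entails_trans HN); [apply (entails_fst HN)|exact h].
      -- apply (entails_curry HN); project.
    * intro h.
      apply (entails_inter HN (U := Omega N)); [exact inh|].
      do 2 apply (entails_curry HN).
      (* The hypothesis is used at [q]; [l q] comes from [l p] and [arrow p q] by monotonicity of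
         [l]. *)
      apply (@entails_cut _ HN _ _ _ _ (fun iu => snd iu) _ h).
      apply (entails_pair HN); [|project].
      apply (@monotone_use _ _ (fun iu => fst iu) _ _ ml); project.
Qed.

End Operations.

(** * Degrees *)

Section Degrees.

Variables (T : Type) (le : relation T).
Hypothesis le_preorder : preorder T le.

Definition degree_of (x : T) : degree le :=
  Degree (ex_intro _ x eq_refl).

Definition representative (c : degree le) : T :=
  proj1_sig (constructive_indefinite_description _ (class_spec c)).

Lemma degree_ext (c d : degree le) : class c = class d -> c = d.
Proof.
destruct c as [c hc], d as [d hd]; cbn; intros <-; f_equal.
apply proof_irrelevance.
Qed.

Lemma degree_of_representative (c : degree le) :
  degree_of (representative c) = c.
Proof.
apply degree_ext; symmetry.
exact (proj2_sig (constructive_indefinite_description _ (class_spec c))).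
Qed.

Lemma degree_le_of (x y : T) :
  degree_le le (degree_of x) (degree_of y) <-> le x y.
Proof.
destruct le_preorder as [r t]; split.
- intros [x' [y' [[hx _] [[_ hy] h]]]]; cbn in *; eauto.
- intro h; exists x, y; cbn; auto.
Qed.

Lemma degree_le_representative (c d : degree le) :
  degree_le le c d <-> le (representative c) (representative d).
Proof.
now rewrite <- degree_le_of, !degree_of_representative.
Qed.

Lemma degree_of_eq (x y : T) : le x y -> le y x -> degree_of x = degree_of y.
Proof.
destruct le_preorder as [r t]; intros h h'; apply degree_ext; cbn.
apply functional_extensionality; intro z; apply propositional_extensionality.
split; intros [h1 h2]; eauto.
Qed.

Lemma degree_le_order : order (degree le) (degree_le le).
Proof.
destruct le_preorder as [r t]; split.
- intro c; apply degree_le_representative, r.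
- intros c d e; rewrite !degree_le_representative; apply t.
- intros c d; rewrite !degree_le_representative; intros h h'.
  rewrite <- (degree_of_representative c), <- (degree_of_representative d).
  now apply degree_of_eq.
Qed.

End Degrees.

Lemma degree_heyting (T : Type) (le : relation T) :
  preheyting le -> heyting_algebra (degree_le le).
Proof.
intros [po [bot [top [meet [join [imp [h1 [h2 [h3 [h4 h5]]]]]]]]]].
split; [exact (degree_le_order po)|].
pose (lift := fun (op : T -> T -> T) (c d : degree le) =>
  degree_of le (op (representative c) (representative d))).
exists (degree_of le bot), (degree_of le top), (lift meet), (lift join), (lift imp).
assert (hl : forall x c, degree_le le (degree_of le x) c <-> le x (representative c))
  by (intros x c; rewrite <- (degree_of_representative c) at 1; now apply degree_le_of).
assert (hr : forall x c, degree_le le c (degree_of le x) <-> le (representative c) x)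
  by (intros x c; rewrite <- (degree_of_representative c) at 1; now apply degree_le_of).
(* The meet of representatives is only equivalent to the representative of the meet; the implication
   law, with a meet on its left, needs both directions. *)
assert (hm : forall c d, le (meet (representative c) (representative d))
                            (representative (lift meet c d)))
  by (intros c d; apply hl, (ord_refl _ _ (degree_le_order po))).
assert (hm' : forall c d, le (representative (lift meet c d))
                             (meet (representative c) (representative d)))
  by (intros c d; apply hr, (ord_refl _ _ (degree_le_order po))).
split; [|split; [|split; [|split]]].
- intro c; apply hl, h1.
- intro c; apply hr, h2.
- intros c d e; unfold lift; rewrite hr, h3, !(degree_le_representative po).
  reflexivity.
- intros c d e; unfold lift; rewrite hl, h4, !(degree_le_representative po).
  reflexivity.
- intros c d e; unfold lift at 1; rewrite hr, h5, (degree_le_representative po).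
  destruct po as [r t]; split; intro h; eauto.
Qed.

(** * Equivalences of preorders *)

Section Transport.

Variables (S T : Type) (leS : relation S) (leT : relation T).
Variables (f : S -> T) (g : T -> S).
Hypothesis f_le : forall x y, leS x y <-> leT (f x) (f y).
Hypothesis fg : forall y, leT (f (g y)) y /\ leT y (f (g y)).

(** The maps are inverse up to equivalence, so [g] is both a left and a right adjoint of [f]; the
    two adjunctions carry each law across. *)
Lemma preheyting_transport : preheyting leT -> preheyting leS.
Proof.
intros [[r t] [bot [top [meet [join [imp [h1 [h2 [h3 [h4 h5]]]]]]]]]].
assert (hl : forall x y, leS (g y) x <-> leT y (f x)).
{ intros x y; rewrite f_le; split; intro h; eapply t; try exact h; apply fg. }
assert (hr : forall x y, leS x (g y) <-> leT (f x) y).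
{ intros x y; rewrite f_le; split; intro h; eapply t; try exact h; apply fg. }
split; [split|].
- intro x; apply f_le, r.
- intros x y z; rewrite !f_le; apply t.
- exists (g bot), (g top), (fun x y => g (meet (f x) (f y))),
    (fun x y => g (join (f x) (f y))), (fun x y => g (imp (f x) (f y))).
  split; [|split; [|split; [|split]]].
  + intro x; apply hl, h1.
  + intro x; apply hr, h2.
  + intros x y z; rewrite hr, h3, !f_le; reflexivity.
  + intros x y z; rewrite hl, h4, !f_le; reflexivity.
  + intros x y z; rewrite hr, hl, h5; reflexivity.
Qed.

(** On degrees [fg] becomes an equation; the other inverse law follows by antisymmetry, as [f]
    reflects the order. *)
Lemma degrees_isomorphic : preorder S leS -> preorder T leT ->
  order_isomorphic (degree_le leS) (degree_le leT).
Proof.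
intros pS pT; assert (tT := preord_trans _ _ pT).
exists (fun c => degree_of leT (f (representative c))).
assert (hf : forall c d, degree_le leS c d <->
  degree_le leT (degree_of leT (f (representative c)))
                (degree_of leT (f (representative d)))).
{ intros c d; now rewrite (degree_le_of pT), <- f_le, (degree_le_representative pS). }
split; [|exact hf].
exists (fun d => degree_of leS (g (representative d))).
assert (hg : forall d, degree_of leT (f (representative
  (degree_of leS (g (representative d))))) = d).
{ intro d; rewrite <- (degree_of_representative d) at 2.
  destruct (fg (representative d)) as [h1 h2].
  apply (degree_of_eq pT); eapply tT; try eassumption; apply f_le;
    rewrite <- (degree_le_of pS), degree_of_representative;
    apply (ord_refl _ _ (degree_le_order pS)). }
split; [|exact hg].
intro c; apply (ord_antisym _ _ (degree_le_order pS)); apply hf; rewrite hg;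
  apply (ord_refl _ _ (degree_le_order pT)).
Qed.

End Transport.

(** * Computable functions *)

#[local] Arguments to_nat _ : simpl never.
#[local] Arguments of_nat _ : simpl never.

Notation "⟨ a , b ⟩" := (to_nat (a, b)) (format "⟨ a ,  b ⟩").
Notation π1 n := (fst (of_nat n)).
Notation π2 n := (snd (of_nat n)).

Lemma left_pair (a b : nat) : π1 ⟨a, b⟩ = a.
Proof. now rewrite cancel_of_to. Qed.

Lemma right_pair (a b : nat) : π2 ⟨a, b⟩ = b.
Proof. now rewrite cancel_of_to. Qed.

Lemma pair_eta (n : nat) : ⟨π1 n, π2 n⟩ = n.
Proof. rewrite <- (surjective_pairing (of_nat n)); apply cancel_to_of. Qed.

Lemma computable_ext (f g : nat -> nat) :
  computable_seq f -> (forall n, g n = f n) -> computable_seq g.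
Proof. intros [c hc] h; exists c; intro n; rewrite h; apply hc. Qed.

Lemma computable_id : computable_seq (fun n => n).
Proof.
exists (cpair cleft cright); intro n; exists (π1 n), (π2 n).
now rewrite pair_eta.
Qed.

Lemma computable_comp (g f : nat -> nat) : computable_seq g ->
  computable_seq f -> computable_seq (fun n => g (f n)).
Proof.
intros [d hd] [c hc]; exists (ccomp d c); intro n; exists (f n); auto.
Qed.

Lemma computable_const (k : nat) : computable_seq (fun _ => k).
Proof.
induction k as [|k [c hc]]; [exists czero; reflexivity|].
exists (ccomp csucc c); intro n; exists k; cbn; auto.
Qed.

Lemma computable_S (f : nat -> nat) :
  computable_seq f -> computable_seq (fun n => S (f n)).
Proof. apply (@computable_comp S); exists csucc; reflexivity. Qed.

Lemma computable_left (f : nat -> nat) :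
  computable_seq f -> computable_seq (fun n => π1 (f n)).
Proof. apply (@computable_comp (fun n => π1 n)); exists cleft; reflexivity. Qed.

Lemma computable_right (f : nat -> nat) :
  computable_seq f -> computable_seq (fun n => π2 (f n)).
Proof. apply (@computable_comp (fun n => π2 n)); exists cright; reflexivity. Qed.

Lemma computable_pair (f g : nat -> nat) : computable_seq f ->
  computable_seq g -> computable_seq (fun n => ⟨f n, g n⟩).
Proof.
intros [c hc] [d hd]; exists (cpair c d); intro n; exists (f n), (g n); auto.
Qed.

Definition computable2 (g : nat -> nat -> nat) : Prop :=
  computable_seq (fun q => g (π1 q) (π2 q)).

Lemma computable_comp2 (g : nat -> nat -> nat) (a b : nat -> nat) :
  computable2 g -> computable_seq a -> computable_seq b ->
  computable_seq (fun n => g (a n) (b n)).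
Proof.
intros hg ha hb.
apply (computable_ext (computable_comp hg (computable_pair ha hb))).
intro n; now rewrite left_pair, right_pair.
Qed.

(** A named recursor gives the tactic [computable] a pattern to recognise. *)
Definition recursion (a : nat) (g : nat -> nat -> nat) : nat -> nat :=
  nat_rect (fun _ => nat) a g.

Lemma recursion_succ (a : nat) (g : nat -> nat -> nat) (n : nat) :
  recursion a g (S n) = g n (recursion a g n).
Proof. reflexivity. Qed.

Lemma computable_recursion (a k : nat -> nat) (g : nat -> nat -> nat -> nat) :
  computable_seq a ->
  computable_seq (fun q => g (π1 q) (π1 (π2 q)) (π2 (π2 q))) ->
  computable_seq k -> computable_seq (fun n => recursion (a n) (g n) (k n)).
Proof.
intros [c hc] [d hd] hk.
apply (computable_ext
  (f := fun n => (fun q => recursion (a (π1 q)) (g (π1 q)) (π2 q)) ⟨n, k n⟩)).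
- apply (@computable_comp (fun q => recursion (a (π1 q)) (g (π1 q)) (π2 q))).
  + exists (cprec c d); intro q.
    exists (recursion (a (π1 q)) (g (π1 q))); split; [apply hc|split; [|reflexivity]].
    intros i _.
    assert (h := hd ⟨π1 q, ⟨i, recursion (a (π1 q)) (g (π1 q)) i⟩⟩).
    rewrite left_pair, right_pair, left_pair, right_pair in h; exact h.
  + apply computable_pair; [apply computable_id|exact hk].
- intro n; cbv beta; now rewrite left_pair, right_pair.
Qed.

(** Case analysis is a recursion whose step ignores the accumulated value: the last step runs at the
    predecessor of [t n]. *)
Lemma computable_match (t a : nat -> nat) (b : nat -> nat -> nat) :
  computable_seq t -> computable_seq a ->
  computable2 b ->
  computable_seq (fun n => match t n with 0 => a n | S m => b n m end).
Proof.
intros ht ha hb.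
apply (computable_ext (f := fun n => recursion (a n) (fun i _ => b n i) (t n))).
- apply computable_recursion; auto.
  apply (computable_comp2 hb); repeat first
    [apply computable_left|apply computable_right|apply computable_id].
- intro n; now destruct (t n).
Qed.

Create HintDb computable.

Ltac computability_step :=
  match goal with
  | |- computable2 _ => unfold computable2; cbv beta
  | |- computable_seq (fun _ => ?k) => exact (computable_const k)
  | |- computable_seq (fun n => n) => exact computable_id
  | |- computable_seq (fun n => S _) => apply computable_S
  | |- computable_seq (fun n => ⟨_, _⟩) => apply computable_pair
  | |- computable_seq (fun n => π1 _) => apply computable_left
  | |- computable_seq (fun n => π2 _) => apply computable_right
  | |- computable_seq (fun n => recursion _ _ _) => apply computable_recursion
  | |- computable_seq (fun n => match _ with 0 => _ | S _ => _ end) =>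
      apply computable_match
  | h : computable_seq ?f |- computable_seq (fun n => ?f _) =>
      apply (computable_comp h)
  | h : computable2 ?f |- computable_seq (fun n => ?f _ _) =>
      apply (computable_comp2 h)
  | |- _ => solve [auto with computable]
  | |- computable_seq (fun n => ?f (@?a n) (@?b n)) =>
      apply (@computable_comp2 f a b); [solve [auto with computable]| |]
  | |- computable_seq (fun n => ?f (@?a n)) =>
      apply (@computable_comp f a); [solve [auto with computable]|]
  end.
Ltac computable := repeat computability_step.

Lemma computable_pred : computable_seq pred.
Proof.
apply (computable_ext (f := fun n => match n with 0 => 0 | S m => m end)).
- computable.
- now intros [|n].
Qed.
#[local] Hint Resolve computable_pred : computable.

Lemma computable_add : computable2 Nat.add.
Proof.
apply (computable_ext (f := fun q => recursion (π2 q) (fun _ s => S s) (π1 q))).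
- computable.
- intro q; induction (π1 q); cbn; congruence.
Qed.
#[local] Hint Resolve computable_add : computable.

Definition parity (n : nat) : nat := if Nat.even n then 0 else 1.

Lemma computable_parity : computable_seq parity.
Proof.
apply (computable_ext (f := recursion 0 (fun _ s => match s with 0 => 1 | S _ => 0 end))).
- apply (computable_recursion (a := fun _ => 0)
    (g := fun _ _ s => match s with 0 => 1 | S _ => 0 end) (k := fun n => n));
  computable.
- unfold parity; induction n as [|n IH]; [reflexivity|].
  rewrite Nat.even_succ, <- Nat.negb_even; cbn; rewrite <- IH.
  now destruct (Nat.even n).
Qed.
#[local] Hint Resolve computable_parity : computable.

(** The half of [S i] exceeds the half of [i] exactly when [i] is odd. *)
Lemma computable_div2 : computable_seq Nat.div2.
Proof.
apply (computable_ext (f := recursion 0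
  (fun i s => match parity i with 0 => s | S _ => S s end))).
- apply (computable_recursion (a := fun _ => 0)
    (g := fun _ i s => match parity i with 0 => s | S _ => S s end)
    (k := fun n => n)); computable.
- induction n as [|n IH]; [reflexivity|]; cbn [recursion nat_rect].
  change (nat_rect (fun _ => nat) 0 ?g n) with (recursion 0 g n).
  rewrite <- IH; unfold parity.
  destruct (Nat.even n) eqn:e.
  + apply Nat.even_spec in e; destruct e as [m ->].
    rewrite Nat.div2_succ_double, Nat.div2_double; reflexivity.
  + assert (o : Nat.odd n = true) by (rewrite <- Nat.negb_even, e; reflexivity).
    apply Nat.odd_spec in o; destruct o as [m ->].
    replace (S (2 * m + 1)) with (2 * S m) by lia.
    rewrite Nat.div2_double, Nat.add_1_r, Nat.div2_succ_double; reflexivity.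
Qed.
#[local] Hint Resolve computable_div2 : computable.

(** * Kleene's first algebra *)

(** Stack machine running [code]. A state [<stack, <S e, n>>] asks for the value
    of program [e] at [n], and [<stack, <0, v>>] returns [v] to the top frame of
    the stack. Frames, as pairs of a tag and data:
    - tag 0, [<g, n>]: left component of [cpair _ g] at [n] awaited;
    - tag 1, [a]: right component awaited, the left one being [a];
    - tag 2, [f]: argument of [f] awaited;
    - tag 3, [<g, <a, <i, r>>>]: [s i] of a [cprec _ g] awaited, [r] further steps
      remaining;
    - tag 4, [<f, <n, m>>]: test of [m] in [cmin f] at [n] awaited. *)
Definition call (stack e n : nat) : nat := ⟨stack, ⟨S e, n⟩⟩.
Definition return_to (stack v : nat) : nat := ⟨stack, ⟨0, v⟩⟩.
Definition push (tag data stack : nat) : nat := S ⟨⟨tag, data⟩, stack⟩.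

(** Past the four atomic programs, the two lowest binary digits of [e] identify the constructor and
    [h] is the quotient by 4. *)
Definition start (s : nat) : nat :=
  let stack := π1 s in
  let n := π2 (π2 s) in
  match pred (π1 (π2 s)) with
  | 0 => return_to stack 0
  | 1 => return_to stack (S n)
  | 2 => return_to stack (π1 n)
  | 3 => return_to stack (π2 n)
  | S (S (S (S e))) =>
      let h := Nat.div2 (Nat.div2 e) in
      match parity (Nat.div2 e) with
      | 0 =>
          match parity e with
          | 0 => call (push 0 ⟨π2 h, n⟩ stack) (π1 h) n
          | S _ => call (push 2 (π1 h) stack) (π2 h) n
          end
      | S _ =>
          match parity e with
          | 0 => call (push 3 ⟨π2 h, ⟨π1 n, ⟨0, π2 n⟩⟩⟩ stack) (π1 h) (π1 n)
          | S _ => call (push 4 ⟨h, ⟨n, 0⟩⟩ stack) h ⟨n, 0⟩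
          end
      end
  end.

Definition resume (s : nat) : nat :=
  let tag := π1 (π1 (pred (π1 s))) in
  let d := π2 (π1 (pred (π1 s))) in
  let stack := π2 (pred (π1 s)) in
  let v := π2 (π2 s) in
  match tag with
  | 0 => call (push 1 v stack) (π1 d) (π2 d)
  | 1 => return_to stack ⟨d, v⟩
  | 2 => call stack d v
  | 3 =>
      let a := π1 (π2 d) in
      let i := π1 (π2 (π2 d)) in
      match π2 (π2 (π2 d)) with
      | 0 => return_to stack v
      | S r => call (push 3 ⟨π1 d, ⟨a, ⟨S i, r⟩⟩⟩ stack) (π1 d) ⟨a, ⟨i, v⟩⟩
      end
  | _ =>
      let n := π1 (π2 d) in
      let m := π2 (π2 d) in
      match v with
      | 0 => return_to stack m
      | S _ => call (push 4 ⟨π1 d, ⟨n, S m⟩⟩ stack) (π1 d) ⟨n, S m⟩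
      end
  end.

(** The empty stack is 0. Returning to it is a fixed point, so running beyond the halting time
    changes nothing. *)
Definition step (s : nat) : nat :=
  match π1 (π2 s) with
  | 0 => match π1 s with 0 => s | S _ => resume s end
  | S _ => start s
  end.

Lemma computable_start : computable_seq start.
Proof. unfold start, call, return_to, push; cbv zeta; computable. Qed.

Lemma computable_resume : computable_seq resume.
Proof. unfold resume, call, return_to, push; cbv zeta; computable. Qed.
#[local] Hint Resolve computable_start computable_resume : computable.

Lemma computable_step : computable_seq step.
Proof. unfold step; computable. Qed.
#[local] Hint Resolve computable_step : computable.

(** * Correctness of the stack machine and the universal program *)

Inductive steps (s : nat) : nat -> Prop :=
| steps_refl : steps s s
| steps_next t : steps (step s) t -> steps s t.

Lemma steps_trans (s t u : nat) : steps s t -> steps t u -> steps s u.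
Proof. induction 1; intros; auto using steps_next. Qed.

Lemma parity_double (k : nat) : parity (2 * k) = 0.
Proof. unfold parity; now rewrite Nat.even_mul. Qed.

Lemma parity_succ_double (k : nat) : parity (S (2 * k)) = 1.
Proof. unfold parity; now rewrite Nat.even_succ, Nat.odd_mul. Qed.

Lemma quarter (e : nat) :
  (parity (4 * e) = 0 /\ Nat.div2 (4 * e) = 2 * e) /\
  (parity (S (4 * e)) = 1 /\ Nat.div2 (S (4 * e)) = 2 * e) /\
  (parity (S (S (4 * e))) = 0 /\ Nat.div2 (S (S (4 * e))) = S (2 * e)) /\
  (parity (S (S (S (4 * e)))) = 1 /\ Nat.div2 (S (S (S (4 * e)))) = S (2 * e)).
Proof.
replace (4 * e) with (2 * (2 * e)) by lia.
replace (S (S (2 * (2 * e)))) with (2 * S (2 * e)) by lia.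
now rewrite !parity_double, !parity_succ_double, !Nat.div2_double,
  !Nat.div2_succ_double.
Qed.

Lemma step_call (stack e n : nat) : step (call stack e n) = start (call stack e n).
Proof. unfold step, call; now rewrite right_pair, left_pair. Qed.

Lemma step_return (tag d stack v : nat) :
  step (return_to (push tag d stack) v) = resume (return_to (push tag d stack) v).
Proof. unfold step, return_to, push; now rewrite right_pair, !left_pair. Qed.

Ltac machine :=
  eapply steps_next;
  first [rewrite step_call; unfold start | rewrite step_return; unfold resume];
  cbv zeta; unfold call, return_to, push;
  repeat (rewrite ?left_pair, ?right_pair; cbn [pred index Nat.add]).

Ltac decode x :=
  destruct (quarter x) as [[? ?] [[? ?] [[? ?] [? ?]]]];
  repeat match goal with
  | h : parity _ = _ |- _ => rewrite h; clear h
  | h : Nat.div2 _ = _ |- _ => rewrite h; clear h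
  end;
  rewrite ?parity_double, ?parity_succ_double, ?Nat.div2_double,
    ?Nat.div2_succ_double, ?left_pair, ?right_pair; cbn iota.

(** The arbitrary stack lets the induction hypotheses run subprograms below freshly pushed
    frames. *)
Lemma simulation (c : code) : forall n m stack, eval c n m ->
  steps (call stack (index c) n) (return_to stack m).
Proof.
induction c as [| | | |f IHf g IHg|f IHf g IHg|f IHf g IHg|f IHf];
  cbn [eval]; intros n m stack h.
- subst; machine; apply steps_refl.
- subst; machine; apply steps_refl.
- subst; machine; apply steps_refl.
- subst; machine; apply steps_refl.
- destruct h as [a [b [ha [hb ->]]]].
  machine; decode ⟨index f, index g⟩.
  eapply steps_trans; [exact (IHf _ _ (push 0 ⟨index g, n⟩ stack) ha)|].
  machine; eapply steps_trans; [exact (IHg _ _ (push 1 a stack) hb)|].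
  machine; apply steps_refl.
- destruct h as [k [hg hf]].
  machine; decode ⟨index f, index g⟩.
  eapply steps_trans; [exact (IHg _ _ (push 2 (index f) stack) hg)|].
  machine; exact (IHf _ _ stack hf).
- destruct h as [s [h0 [hs ->]]].
  machine; decode ⟨index f, index g⟩.
  eapply steps_trans;
    [exact (IHf _ _ (push 3 ⟨index g, ⟨π1 n, ⟨0, π2 n⟩⟩⟩ stack) h0)|].
  (* Loop invariant: [s i] has just been computed and [r] rounds remain. *)
  assert (loop : forall r i, i + r = π2 n -> steps
    (return_to (push 3 ⟨index g, ⟨π1 n, ⟨i, r⟩⟩⟩ stack) (s i))
    (return_to stack (s (π2 n)))).
  { induction r as [|r IH]; intros i e.
    - rewrite Nat.add_0_r in e; subst i; machine; apply steps_refl.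
    - machine.
      eapply steps_trans; [|apply (IH (S i)); lia].
      refine (IHg _ _ (push 3 ⟨index g, ⟨π1 n, ⟨S i, r⟩⟩⟩ stack) (hs i _)); lia. }
  now apply loop.
- destruct h as [h0 hs].
  machine; decode (index f).
  (* Here [r] counts the positive tests still to come before the zero at [m]. *)
  assert (loop : forall r i, i + r = m -> steps
    (call (push 4 ⟨index f, ⟨n, i⟩⟩ stack) (index f) ⟨n, i⟩) (return_to stack m)).
  { induction r as [|r IH]; intros i e.
    - rewrite Nat.add_0_r in e; subst i.
      eapply steps_trans;
        [exact (IHf _ _ (push 4 ⟨index f, ⟨n, m⟩⟩ stack) h0)|].
      machine; apply steps_refl.
    - destruct (hs i) as [v hv]; [lia|].
      eapply steps_trans; [exact (IHf _ _ (push 4 ⟨index f, ⟨n, i⟩⟩ stack) hv)|].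
      machine; apply (IH (S i)); lia. }
  exact (loop m 0 eq_refl).
Qed.

(** A test for minimisation: it vanishes exactly on halted states, those with an empty stack and a
    value returned. *)
Definition running (s : nat) : nat := π1 s + π1 (π2 s).

Definition run (s t : nat) : nat := recursion s (fun _ => step) t.

Lemma computable_run : computable2 run.
Proof. unfold run; computable. Qed.

Lemma run_succ (s t : nat) : run s (S t) = run (step s) t.
Proof.
unfold run; induction t as [|t IH]; [reflexivity|].
cbn [recursion nat_rect] in *; now rewrite IH.
Qed.

Lemma run_halted (s t : nat) : running s = 0 -> run s t = s.
Proof.
intro h; unfold running in h; induction t as [|t IH]; [reflexivity|].
rewrite run_succ; replace (step s) with s; [exact IH|].
unfold step; now replace (π1 (π2 s)) with 0 by lia; replace (π1 s) with 0 by lia.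
Qed.

Lemma steps_run (s s' : nat) : steps s s' -> running s' = 0 ->
  exists t, run s t = s' /\ forall t', t' < t -> running (run s t') <> 0.
Proof.
intros h h0; induction h as [s|s s' h IH].
- exists 0; split; [reflexivity|lia].
- destruct (Nat.eq_dec (running s) 0) as [e|e].
  + destruct IH as [t [ht _]]; [exact h0|].
    (* A halted state is its own successor, so [s] already equals [s']. *)
    exists 0; split; [|lia].
    rewrite <- run_succ, run_halted in ht; assumption.
  + destruct IH as [t [ht lt]]; [exact h0|].
    exists (S t); split; [now rewrite run_succ|].
    intros [|t'] l; [exact e|rewrite run_succ; apply lt; lia].
Qed.

(** Kleene's normal form: minimise the halting time of the machine, run it that long, and read off
    the returned value. *)
Lemma universal_ex : exists u, forall c n m,
  eval c n m -> eval u ⟨index c, n⟩ m.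
Proof.
assert (ht : computable_seq
  (fun q => running (run (call 0 (π1 (π1 q)) (π2 (π1 q))) (π2 q)))).
{ assert (h := computable_run); unfold running, call; computable. }
assert (ho : computable_seq
  (fun q => π2 (π2 (run (call 0 (π1 (π1 q)) (π2 (π1 q))) (π2 q))))).
{ assert (h := computable_run); unfold call; computable. }
destruct computable_id as [i hi], ht as [t ht], ho as [o ho].
exists (ccomp o (cpair i (cmin t))); intros c n m h.
destruct (steps_run (simulation 0 h)) as [k [hk lk]].
{ unfold running, return_to; now rewrite right_pair, !left_pair. }
exists ⟨⟨index c, n⟩, k⟩; split.
- exists ⟨index c, n⟩, k; split; [apply hi|split; [|reflexivity]]; split.
  + assert (e := ht ⟨⟨index c, n⟩, k⟩).
    rewrite !left_pair, !right_pair, hk in e.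
    unfold running, return_to in e; now rewrite right_pair, !left_pair in e.
  + intros j l; assert (e := ht ⟨⟨index c, n⟩, j⟩).
    rewrite !left_pair, !right_pair in e; apply lk in l.
    destruct (running _) as [|v] in *; [easy|eauto].
- assert (e := ho ⟨⟨index c, n⟩, k⟩).
  rewrite !left_pair, !right_pair, hk in e.
  unfold return_to in e; now rewrite !right_pair in e.
Qed.

Lemma eval_functional (c : code) : forall n m m',
  eval c n m -> eval c n m' -> m = m'.
Proof.
induction c as [| | | |f IHf g IHg|f IHf g IHg|f IHf g IHg|f IHf];
  cbn [eval]; intros n m m' h h'; try congruence.
- destruct h as [a [b [ha [hb ->]]]], h' as [a' [b' [ha' [hb' ->]]]].
  now rewrite (IHf _ _ _ ha ha'), (IHg _ _ _ hb hb').
- destruct h as [a [ha hm]], h' as [a' [ha' hm']].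
  rewrite <- (IHg _ _ _ ha ha') in hm'; eauto.
- destruct h as [s [h0 [hs ->]]], h' as [s' [h0' [hs' ->]]].
  assert (H : forall i, i <= π2 n -> s i = s' i); [|now apply H].
  induction i as [|i IH]; intro l; [eauto|].
  assert (e := IH (Nat.lt_le_incl _ _ l)).
  assert (h := hs i l); rewrite e in h; eauto.
- destruct h as [h0 hs], h' as [h0' hs'].
  destruct (Nat.lt_trichotomy m m') as [l|[e|l]]; [|exact e|].
  + destruct (hs' _ l) as [v hv]; now specialize (IHf _ _ _ h0 hv).
  + destruct (hs _ l) as [v hv]; now specialize (IHf _ _ _ h0' hv).
Qed.

Lemma index_inj (c : code) : forall d, index c = index d -> c = d.
Proof.
assert (inj : forall a b a' b', ⟨a, b⟩ = ⟨a', b'⟩ -> a = a' /\ b = b')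
  by (intros a b a' b' h; apply to_nat_inj in h; now injection h).
induction c; destruct d; cbn [index]; intro h; try reflexivity; try lia.
- destruct (inj (index c1) (index c2) (index d1) (index d2)); [lia|]; f_equal; auto.
- destruct (inj (index c1) (index c2) (index d1) (index d2)); [lia|]; f_equal; auto.
- destruct (inj (index c1) (index c2) (index d1) (index d2)); [lia|]; f_equal; auto.
- f_equal; apply IHc; lia.
Qed.

Fixpoint numeral (n : nat) : code :=
  match n with 0 => czero | S n => ccomp csucc (numeral n) end.

Lemma eval_numeral (k n : nat) : eval (numeral k) n k.
Proof. induction k; cbn; eauto. Qed.

Lemma computable_index_numeral : computable_seq (fun n => index (numeral n)).
Proof.
(* The 1 is the index of [csucc]; multiplication by 4 is spelled out by additions. *)
apply (computable_ext (f := recursion 0 (fun _ s =>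
  5 + ((⟨1, s⟩ + ⟨1, s⟩) + (⟨1, s⟩ + ⟨1, s⟩))))).
- apply (computable_recursion (a := fun _ => 0) (g := fun _ _ s =>
    5 + ((⟨1, s⟩ + ⟨1, s⟩) + (⟨1, s⟩ + ⟨1, s⟩))) (k := fun n => n)); cbn [Nat.add]; computable.
- induction n as [|n IH]; [reflexivity|].
  cbn [numeral index]; rewrite IH; cbn [recursion nat_rect]; unfold recursion; lia.
Qed.
#[local] Hint Resolve computable_index_numeral : computable.

Lemma K1_app (c : code) (n m : nat) : eval c n m -> @app K1 (index c) n m.
Proof. intro h; exists c; auto. Qed.

Lemma K1_computable (f : nat -> nat) : computable_seq f ->
  exists e : K1, computable e /\ forall n, app e n (f n).
Proof.
intros [c hc]; exists (index c); split; [exact Logic.I|].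
intro n; apply K1_app, hc.
Qed.

Lemma K1_combinatory : combinatory K1.
Proof.
destruct universal_ex as [u hu]; destruct computable_id as [i hi].
(* The universal program with [e] hard-wired covers any number [e]. *)
assert (program : forall e : K1, exists c, forall n m, app e n m -> eval c n m).
{ intro e; exists (ccomp u (cpair (numeral e) i)); intros n m [c [<- h]].
  exists ⟨index c, n⟩; split; [|now apply hu].
  exists (index c), n; split; [apply eval_numeral|split; [apply hi|reflexivity]]. }
split.
- intros e n m m' [c [hc h]] [d [hd h']].
  assert (c = d) as <- by (apply index_inj; congruence).
  exact (eval_functional h h').
- exact Logic.I.
- exact Logic.I.
- discriminate.
- intros a _; exact (K1_computable (computable_const a)).
- intros d e _ _; destruct (program d) as [c hc], (program e) as [c' hc'].
  exists (index (ccomp u (cpair c c'))); split; [exact Logic.I|].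
  intros x y z w h1 h2 [b [<- h3]]; apply K1_app.
  exists ⟨index b, z⟩; split; [exists (index b), z; auto|auto].
- intros d e _ _; destruct (program d) as [c hc], (program e) as [c' hc'].
  exists (index (cpair c c')); split; [exact Logic.I|].
  intros x y z h1 h2; apply K1_app; exists y, z; auto.
- exists (index cleft); split; [exact Logic.I|].
  intros x y; apply K1_app; cbn; now rewrite left_pair.
- exists (index cright); split; [exact Logic.I|].
  intros x y; apply K1_app; cbn; now rewrite right_pair.
- intros e _; destruct (program e) as [c hc].
  (* This is the s-m-n theorem: the index of the program with first argument [x] hard-wired is
     computable from [x]. *)
  destruct (@K1_computable (fun x => index (ccomp c (cpair (numeral x) i))))
    as [f [hf ef]].
  { cbn [index].
    apply (computable_ext (f := fun x =>
      let q := ⟨index c, 4 + (⟨index (numeral x), index i⟩ + ⟨index (numeral x), index i⟩ +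
        (⟨index (numeral x), index i⟩ + ⟨index (numeral x), index i⟩))⟩ in
      5 + (q + q + (q + q)))).
    - cbn [Nat.add]; cbv zeta; computable.
    - intro x; cbv zeta.
      replace (4 * ⟨index (numeral x), index i⟩) with
        (⟨index (numeral x), index i⟩ + ⟨index (numeral x), index i⟩ +
        (⟨index (numeral x), index i⟩ + ⟨index (numeral x), index i⟩)) by lia.
      lia. }
  exists f; split; [exact hf|]; intro x.
  exists (index (ccomp c (cpair (numeral x) i))); split; [apply ef|].
  intros y z h; apply K1_app; exists ⟨x, y⟩; split; [|now apply hc].
  exists x, y; split; [apply eval_numeral|split; [apply hi|reflexivity]].
- intros a b _ _.
  destruct (@K1_computable (fun n => match π1 n with 0 => a | S _ => b end))
    as [f [hf ef]].
  { computable. }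
  exists f; split; [exact hf|]; split; intro x.
  + assert (h := ef ⟨0, x⟩); now rewrite left_pair in h.
  + assert (h := ef ⟨1, x⟩); now rewrite left_pair in h.
Qed.

(** * Baire space *)

Lemma computable_sub : computable2 Nat.sub.
Proof.
apply (computable_ext (f := fun q => recursion (π1 q) (fun _ => pred) (π2 q))).
- computable.
- intro q; induction (π2 q) as [|n IH]; cbn; [lia|].
  rewrite Nat.sub_succ_r, IH; reflexivity.
Qed.
#[local] Hint Resolve computable_sub : computable.

(** * Decoding finite sequences *)

Definition head (q : nat) : nat := π1 (pred q).
Definition tail (q : nat) : nat := π2 (pred q).

Lemma computable_head : computable_seq head.
Proof. unfold head; computable. Qed.

Lemma computable_tail : computable_seq tail.
Proof. unfold tail; computable. Qed.
#[local] Hint Resolve computable_head computable_tail : computable.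

Lemma head_cons (n l : nat) : head (S ⟨n, l⟩) = n.
Proof. apply left_pair. Qed.

Lemma tail_cons (n l : nat) : tail (S ⟨n, l⟩) = l.
Proof. apply right_pair. Qed.

Definition drop (l i : nat) : nat := recursion l (fun _ => tail) i.
Definition entry (l i : nat) : nat := head (drop l i).
(** Counts the nonempty tails; a code is at least as large as the length it encodes, so [l] rounds
    suffice. *)
Definition size (l : nat) : nat :=
  recursion 0 (fun i s => match drop l i with 0 => s | S _ => S s end) l.

Lemma computable_drop : computable2 drop.
Proof. unfold drop; computable. Qed.
#[local] Hint Resolve computable_drop : computable.

Lemma computable_entry : computable2 entry.
Proof. unfold entry; computable. Qed.

Lemma computable_size : computable_seq size.
Proof. unfold size; computable. Qed.
#[local] Hint Resolve computable_entry computable_size : computable.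

Lemma drop_seq_code (l : list nat) (i : nat) :
  drop (seq_code l) i = seq_code (skipn i l).
Proof.
induction i as [|i IH]; [reflexivity|].
unfold drop in *; rewrite recursion_succ, IH.
replace (skipn (S i) l) with (skipn 1 (skipn i l)) by now rewrite skipn_skipn.
destruct (skipn i l) as [|a l']; [reflexivity|apply tail_cons].
Qed.

Lemma le_pair (a b : nat) : b <= ⟨a, b⟩.
Proof. assert (h := to_nat_non_decreasing a b); lia. Qed.

Lemma length_le_seq_code (l : list nat) : length l <= seq_code l.
Proof.
induction l as [|a l IH]; cbn; [lia|].
assert (h := le_pair a (seq_code l)); lia.
Qed.

Lemma size_seq_code (l : list nat) : size (seq_code l) = length l.
Proof.
unfold size.
assert (h : forall k, recursion 0 (fun i s =>
  match drop (seq_code l) i with 0 => s | S _ => S s end) k = min k (length l)).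
{ induction k as [|k IH]; [reflexivity|].
  rewrite recursion_succ, IH, drop_seq_code.
  assert (e := length_skipn k l).
  destruct (skipn k l); cbn [seq_code length] in *; lia. }
rewrite h; assert (h' := length_le_seq_code l); lia.
Qed.

Definition prefix (x : nat -> nat) (k : nat) : nat := seq_code (map x (seq 0 k)).

Lemma query_cons (n : nat) (x : nat -> nat) (k : nat) :
  query n x k = S ⟨n, prefix x k⟩.
Proof. reflexivity. Qed.

Lemma head_query (n : nat) (x : nat -> nat) (k : nat) : head (query n x k) = n.
Proof. apply head_cons. Qed.

Lemma size_query (n : nat) (x : nat -> nat) (k : nat) :
  size (tail (query n x k)) = k.
Proof.
rewrite query_cons, tail_cons; unfold prefix.
now rewrite size_seq_code, length_map, length_seq.
Qed.

Lemma entry_query (n : nat) (x : nat -> nat) (k i : nat) : i < k ->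
  entry (tail (query n x k)) i = x i.
Proof.
intro h; rewrite query_cons, tail_cons; unfold entry, prefix.
rewrite drop_seq_code, skipn_map, skipn_seq; cbn.
destruct (k - i) eqn:e; [lia|]; apply head_cons.
Qed.

(** Recursion prepends entries, so the list is built from its last entry; after [i] rounds the last
    [i] entries are present. *)
Lemma prefix_recursion (x : nat -> nat) (k : nat) :
  prefix x k = recursion 0 (fun i s => S ⟨x (k - S i), s⟩) k.
Proof.
assert (h : forall i, i <= k ->
  seq_code (map x (seq (k - i) i)) =
  recursion 0 (fun i s => S ⟨x (k - S i), s⟩) i).
{ induction i as [|i IH]; intro l; [reflexivity|].
  rewrite recursion_succ; cbn [seq map seq_code].
  replace (S (k - S i)) with (k - i) by lia.
  rewrite IH by lia; reflexivity. }
rewrite <- h by lia; now rewrite Nat.sub_diag.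
Qed.

Lemma computable_query (n k : nat -> nat) (x : nat -> nat -> nat) :
  computable_seq n -> computable2 x -> computable_seq k ->
  computable_seq (fun p => query (n p) (x p) (k p)).
Proof.
intros hn hx hk.
apply (computable_ext (f := fun p =>
  S ⟨n p, recursion 0 (fun i s => S ⟨x p (k p - S i), s⟩) (k p)⟩)).
- computable.
- intro p; now rewrite query_cons, prefix_recursion.
Qed.

Lemma query_ext (n : nat) (x y : nat -> nat) (k : nat) :
  (forall i, i < k -> x i = y i) -> query n x k = query n y k.
Proof.
intro h; rewrite !query_cons; unfold prefix; do 4 f_equal.
apply map_ext_in; intros i hi; apply h; apply in_seq in hi; lia.
Qed.

(** The first nonzero value among [f 0, ..., f (k - 1)], or [0]. *)
Definition search (f : nat -> nat) (k : nat) : nat :=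
  recursion 0 (fun i s => match s with 0 => f i | S _ => s end) k.

Lemma computable_search (f : nat -> nat -> nat) (k : nat -> nat) :
  computable2 f -> computable_seq k -> computable_seq (fun p => search (f p) (k p)).
Proof. intros hf hk; unfold search; computable. Qed.

Lemma search_succ (f : nat -> nat) (k : nat) :
  search f (S k) = match search f k with 0 => f k | S m => S m end.
Proof. unfold search; rewrite recursion_succ; now destruct (recursion _ _ k). Qed.

Lemma search_zero (f : nat -> nat) (k : nat) :
  (forall i, i < k -> f i = 0) -> search f k = 0.
Proof.
induction k as [|k IH]; intro h; [reflexivity|].
rewrite search_succ, IH by (intros; apply h; lia); apply h; lia.
Qed.

Lemma search_first (f : nat -> nat) (i k m : nat) :
  i < k -> f i = S m -> (forall j, j < i -> f j = 0) -> search f k = S m.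
Proof.
intros l e h; induction k as [|k IH]; [lia|].
rewrite search_succ; destruct (Nat.eq_dec i k) as [->|ne].
- now rewrite search_zero.
- rewrite IH by lia; reflexivity.
Qed.

Lemma search_zero_inv (f : nat -> nat) (k : nat) : search f k = 0 ->
  forall i, i < k -> f i = 0.
Proof.
induction k as [|k IH]; intros h i l; [lia|].
rewrite search_succ in h; destruct (search f k); [|discriminate].
destruct (Nat.eq_dec i k) as [->|ne]; [exact h|apply IH; lia].
Qed.

Lemma search_inv (f : nat -> nat) (k m : nat) : search f k = S m ->
  exists i, i < k /\ f i = S m /\ forall j, j < i -> f j = 0.
Proof.
revert m; induction k as [|k IH]; intros m h; [discriminate|].
rewrite search_succ in h; destruct (search f k) as [|m'] eqn:e.
- exists k; split; [lia|split; [exact h|]].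
  exact (search_zero_inv e).
- destruct (IH m') as [i [l [hi lt]]]; [reflexivity|].
  exists i; split; [lia|split; [congruence|exact lt]].
Qed.

Lemma search_ext (f g : nat -> nat) (k : nat) :
  (forall i, i < k -> f i = g i) -> search f k = search g k.
Proof.
induction k as [|k IH]; intro h; [reflexivity|].
now rewrite !search_succ, IH, h by (auto with arith).
Qed.
#[local] Hint Extern 1 (computable_seq (fun _ => query _ _ _)) =>
  solve [apply computable_query; computable] : computable.
#[local] Hint Extern 1 (computable_seq (fun _ => search _ _)) =>
  solve [apply computable_search; computable] : computable.

(** * Codes as tables of finite approximations *)

Definition finitary (G : nat -> nat -> (nat -> nat) -> nat) : Prop :=
  forall n k x y, (forall i, i < k -> x i = y i) -> G n k x = G n k y.

(** The code with table [G]. Entries decoded beyond the size are junk, which a finitary [G] never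
    sees. *)
Definition element (G : nat -> nat -> (nat -> nat) -> nat) (q : nat) : nat :=
  G (head q) (size (tail q)) (entry (tail q)).

Lemma element_query (G : nat -> nat -> (nat -> nat) -> nat) : finitary G ->
  forall n x k, element G (query n x k) = G n k x.
Proof.
intros hG n x k; unfold element; rewrite head_query, size_query.
apply hG; intros i l; now apply entry_query.
Qed.

Lemma least_stage (f : nat -> nat) (v : nat) :
  (exists k, f k = S v) -> (forall k, f k = 0 \/ f k = S v) ->
  exists k, f k = S v /\ forall i, i < k -> f i = 0.
Proof.
intros [k hk] h.
destruct (search_inv (f := f) (k := S k) (m := v)) as [i [_ hi]].
- rewrite search_succ; destruct (search f k) as [|m] eqn:e; [exact hk|].
  destruct (search_inv e) as [i [_ [hi _]]], (h i); congruence.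
- now exists i.
Qed.

(** A table need only succeed at some stage and never be wrong: the first success, which application
    reads, is then correct. *)
Lemma element_app (G : nat -> nat -> (nat -> nat) -> nat) (x z : nat -> nat) :
  finitary G ->
  (forall n, (exists k, G n k x = S (z n)) /\
             forall k, G n k x = 0 \/ G n k x = S (z n)) ->
  baire_app (element G) x z.
Proof.
intros hG h n; destruct (h n) as [h1 h2].
destruct (least_stage h1 h2) as [k [hk lk]].
exists k; split; [now rewrite element_query|].
intros i l; rewrite element_query; auto.
Qed.

(** [S v] if the first [k] values of [x] determine that [(e * x)(n) = v],
    and [0] otherwise. *)
Definition approx (e : nat -> nat) (n k : nat) (x : nat -> nat) : nat :=
  search (fun i => e (query n x i)) k.

Lemma approx_finitary (e : nat -> nat) : finitary (approx e).
Proof.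
intros n k x y h; apply search_ext; intros i l; f_equal.
apply query_ext; intros; apply h; lia.
Qed.

Lemma computable_approx (e n k : nat -> nat) (x : nat -> nat -> nat) :
  computable_seq e -> computable_seq n -> computable_seq k -> computable2 x ->
  computable_seq (fun p => approx e (n p) (k p) (x p)).
Proof.
intros he hn hk hx; unfold approx; computable.
Qed.
#[local] Hint Extern 1 (computable_seq (fun _ => approx _ _ _ _)) =>
  solve [apply computable_approx; computable] : computable.

Lemma approx_sound (e x z : nat -> nat) : baire_app e x z ->
  forall n k, approx e n k x = 0 \/ approx e n k x = S (z n).
Proof.
intros h n k; destruct (approx e n k x) as [|m] eqn:E; [now left|right].
destruct (search_inv E) as [i [_ [hi li]]], (h n) as [j [hj lj]].
destruct (Nat.lt_trichotomy i j) as [l|[->|l]].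
- rewrite lj in hi by exact l; discriminate.
- congruence.
- rewrite li in hj by exact l; discriminate.
Qed.

Lemma approx_complete (e x z : nat -> nat) : baire_app e x z ->
  forall n, exists m, forall k, m <= k -> approx e n k x = S (z n).
Proof.
intros h n; destruct (h n) as [j [hj lj]].
exists (S j); intros k l; apply (search_first (i := j)); auto.
Qed.

Lemma baire_app_functional (e x z z' : nat -> nat) :
  baire_app e x z -> baire_app e x z' -> z = z'.
Proof.
intros h h'; apply functional_extensionality; intro n.
destruct (approx_complete h n) as [m hm], (approx_complete h' n) as [m' hm'].
specialize (hm (m + m') ltac:(lia)); specialize (hm' (m + m') ltac:(lia)).
congruence.
Qed.

(** Tests whether [i] queries settle the value at [n] of [(d * x) * (e * x)], as
    far as [k] values of [x] tell: [0] is "go on with [i + 1]", [1] is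
    "undetermined" and [S (S m)] is "the value is [m]". *)
Definition share_stage (d e : nat -> nat) (n k : nat) (x : nat -> nat) (i : nat) : nat :=
  match approx d (query n (fun j => pred (approx e j k x)) i) k x with
  | 0 => 1
  | 1 => match approx e i k x with 0 => 1 | S _ => 0 end
  | S (S m) => S (S m)
  end.

(** The search also stops at an undetermined stage, which keeps it from reaching a spurious later
    value; [pred] turns that outcome into 0. *)
Definition share (d e : nat -> nat) (n k : nat) (x : nat -> nat) : nat :=
  pred (search (share_stage d e n k x) k).

Lemma share_finitary (d e : nat -> nat) : finitary (share d e).
Proof.
intros n k x y h; unfold share; f_equal; apply search_ext; intros i _.
unfold share_stage.
rewrite (@approx_finitary e i k x y h), (fun m => @approx_finitary d m k x y h).
replace (query n (fun j => pred (approx e j k x)) i)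
  with (query n (fun j => pred (approx e j k y)) i); [reflexivity|].
apply query_ext; intros j _; now rewrite (@approx_finitary e j k x y h).
Qed.

Lemma computable_share (d e : nat -> nat) : computable_seq d ->
  computable_seq e -> computable_seq (element (share d e)).
Proof.
intros hd he; unfold element, share, share_stage; computable.
Qed.

Lemma eventually_all (P : nat -> nat -> Prop) (i : nat) :
  (forall j, j < i -> exists m, forall k, m <= k -> P j k) ->
  exists m, forall k, m <= k -> forall j, j < i -> P j k.
Proof.
induction i as [|i IH]; intro h; [exists 0; lia|].
destruct IH as [m hm]; [auto with arith|].
destruct (h i) as [m' hm']; [lia|].
exists (m + m'); intros k l j lj; destruct (Nat.eq_dec j i) as [->|ne].
- apply hm'; lia.
- apply hm; lia.
Qed.

Lemma share_app (d e x u v w : nat -> nat) : baire_app d x u ->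
  baire_app e x v -> baire_app u v w -> baire_app (element (share d e)) x w.
Proof.
intros hu hv hw; apply element_app; [apply share_finitary|].
intro n; destruct (hw n) as [i0 [e0 l0]]; split.
- destruct (@eventually_all (fun j k => approx e j k x = S (v j)) i0) as [a ha].
  { intros j _; apply (approx_complete hv). }
  destruct (@eventually_all (fun j k =>
    approx d (query n v j) k x = S (u (query n v j))) (S i0)) as [b hb].
  { intros j _; apply (approx_complete hu). }
  (* So large that all values involved are settled and that the search reaches stage [i0]. *)
  pose (k := a + b + S i0).
  specialize (ha k ltac:(lia)); specialize (hb k ltac:(lia)).
  assert (st : forall i, i <= i0 -> approx d (query n (fun j => pred (approx e j k x)) i) k x
    = S (u (query n v i))).
  { intros i l; rewrite (@query_ext n _ v i); [apply hb; lia|].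
    intros j lj; now rewrite ha by lia. }
  exists k; unfold share; rewrite (@search_first _ i0 k (S (w n))); [reflexivity|lia| |].
  + unfold share_stage; now rewrite st, e0.
  + intros j lj; unfold share_stage; now rewrite st, l0, ha by lia.
- intro k; unfold share; destruct (search _ k) as [|[|m]] eqn:E;
    [now left|now left|right; cbn; f_equal].
  destruct (search_inv E) as [i [_ [hi li]]].
  (* By strong induction, every stage passed had settled values before it, so its query to [u] was
     the true one. *)
  assert (va : forall j, j < i -> approx e j k x = S (v j) /\ u (query n v j) = 0).
  { induction j as [j IH] using lt_wf_ind; intro l.
    specialize (li j l); unfold share_stage in li.
    rewrite (@query_ext n _ v j) in li
      by (intros j' l'; now rewrite (proj1 (IH j' l' ltac:(lia)))).
    destruct (approx_sound hu (query n v j) k) as [h|h]; rewrite h in li; [easy|].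
    destruct (u (query n v j)); [|easy].
    destruct (approx_sound hv j k) as [h'|h']; rewrite h' in li; easy. }
  unfold share_stage in hi.
  rewrite (@query_ext n _ v i) in hi by (intros j l; now rewrite (proj1 (va j l))).
  destruct (approx_sound hu (query n v i) k) as [h|h]; rewrite h in hi; [easy|].
  destruct (u (query n v i)) eqn:ui.
  { destruct (approx e i k x); easy. }
  injection hi as ->.
  destruct (Nat.lt_trichotomy i i0) as [l|[->|l]].
  + rewrite l0 in ui by exact l; discriminate.
  + congruence.
  + rewrite (proj2 (va _ l)) in e0; discriminate.
Qed.

Lemma baire_pair_parity (x y : nat -> nat) (n : nat) :
  baire_pair x y n =
  match parity n with 0 => x (Nat.div2 n) | S _ => y (Nat.div2 n) end.
Proof. unfold baire_pair, parity; now destruct (Nat.even n). Qed.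

Lemma baire_pair_even (x y : nat -> nat) (n : nat) : baire_pair x y (2 * n) = x n.
Proof. unfold baire_pair; now rewrite Nat.even_mul, Nat.div2_double. Qed.

Lemma baire_pair_odd (x y : nat -> nat) (n : nat) : baire_pair x y (S (2 * n)) = y n.
Proof.
unfold baire_pair; now rewrite Nat.even_succ, Nat.odd_mul, Nat.div2_succ_double.
Qed.

Lemma baire_pair_ext (x y x' y' : nat -> nat) (k i : nat) : i < k ->
  (forall j, j < k -> x j = x' j) -> (forall j, j < k -> y j = y' j) ->
  baire_pair x y i = baire_pair x' y' i.
Proof.
intros l h h'; unfold baire_pair.
assert (b := Nat.div2_decr i i ltac:(lia)).
destruct (Nat.even i); [apply h|apply h']; lia.
Qed.

Lemma computable_baire_pair (x y : nat -> nat -> nat) (i : nat -> nat) :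
  computable2 x -> computable2 y -> computable_seq i ->
  computable_seq (fun p => baire_pair (x p) (y p) (i p)).
Proof.
intros hx hy hi.
apply (computable_ext (f := fun p => match parity (i p) with
  0 => x p (Nat.div2 (i p)) | S _ => y p (Nat.div2 (i p)) end)).
- computable.
- intro p; apply baire_pair_parity.
Qed.
#[local] Hint Extern 1 (computable_seq (fun _ => baire_pair _ _ _)) =>
  solve [apply computable_baire_pair; computable] : computable.

Definition pairing (d e : nat -> nat) (n k : nat) (x : nat -> nat) : nat :=
  match parity n with
  | 0 => approx d (Nat.div2 n) k x
  | S _ => approx e (Nat.div2 n) k x
  end.

Lemma pairing_finitary (d e : nat -> nat) : finitary (pairing d e).
Proof.
intros n k x y h; unfold pairing; destruct (parity n); now apply approx_finitary.
Qed.

(** [element (slice e x)] is a code of [fun y => e * <x, y>]. *)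
Definition slice (e x : nat -> nat) (n k : nat) (y : nat -> nat) : nat :=
  approx e n k (baire_pair x y).

Lemma slice_finitary (e x : nat -> nat) : finitary (slice e x).
Proof.
intros n k y y' h; apply approx_finitary; intros i l.
now apply (baire_pair_ext (k := k)).
Qed.

(** The entry at [q] of the code of the slice depends on at most [size (tail q)] values of [x], so
    it is emitted once that many are known. *)
Definition currying (e : nat -> nat) (q m : nat) (x : nat -> nat) : nat :=
  match size (tail q) - m with
  | 0 => S (element (slice e x) q)
  | S _ => 0
  end.

Lemma currying_finitary (e : nat -> nat) : finitary (currying e).
Proof.
intros q m x x' h; unfold currying.
destruct (size (tail q) - m) eqn:E; [|reflexivity]; f_equal.
apply approx_finitary; intros i l.
apply (baire_pair_ext (k := size (tail q))); auto.
intros j lj; apply h; lia.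
Qed.

Section Baire.

Variable P : (nat -> nat) -> Prop.
Hypothesis P_zero : P (fun _ => 0).
(** Stated so as to hold both for all sequences and for the computable ones. *)
Hypothesis P_closed : forall d e f, P d -> P e ->
  (computable_seq d -> computable_seq e -> computable_seq f) -> P f.

Lemma P_computable (f : nat -> nat) : computable_seq f -> P f.
Proof. intro h; exact (P_closed P_zero P_zero (fun _ _ => h)). Qed.

Lemma baire_combinatory : combinatory (baire_algebra P).
Proof.
split; cbn.
- exact baire_app_functional.
- exact P_zero.
- apply P_computable, computable_const.
- intro h; discriminate (f_equal (fun x => x 0) h).
- intros a ha; exists (element (fun n _ _ => S (a n))); split.
  + apply (P_closed ha ha); intros; unfold element; computable.
  + intro x; apply element_app; [easy|].
    intro n; split; [exists 0|right]; reflexivity.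
- intros d e hd he; exists (element (share d e)); split.
  + exact (P_closed hd he (@computable_share d e)).
  + apply share_app.
- intros d e hd he; exists (element (pairing d e)); split.
  + apply (P_closed hd he); intros; unfold element, pairing; computable.
  + intros x u v hu hv; apply element_app; [apply pairing_finitary|].
    intro n; rewrite baire_pair_parity; unfold pairing; destruct (parity n).
    * split; [|now apply approx_sound].
      destruct (approx_complete hu (Nat.div2 n)) as [m hm]; eauto.
    * split; [|now apply approx_sound].
      destruct (approx_complete hv (Nat.div2 n)) as [m hm]; eauto.
(* The difference is positive exactly when position [n + n], the [n]-th even one, is among the [k]
   known values. *)
- exists (element (fun n k x =>
    match k - (n + n) with 0 => 0 | S _ => S (x (n + n)) end)); split.
  + apply P_computable; unfold element; computable.
  + intros x y; apply element_app.
    * intros n k z z' h; destruct (k - (n + n)) eqn:e; [|rewrite h by lia]; reflexivity.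
    * intro n; replace (n + n) with (2 * n) by lia; rewrite baire_pair_even.
      split; [exists (S (2 * n)); now replace (S (2 * n) - 2 * n) with 1 by lia|].
      intro k; destruct (k - 2 * n); auto.
- exists (element (fun n k x =>
    match k - S (n + n) with 0 => 0 | S _ => S (x (S (n + n))) end)); split.
  + apply P_computable; unfold element; computable.
  + intros x y; apply element_app.
    * intros n k z z' h; destruct (k - S (n + n)) eqn:e; [|rewrite h by lia]; reflexivity.
    * intro n; replace (n + n) with (2 * n) by lia; rewrite baire_pair_odd.
      split; [exists (S (S (2 * n))); now replace (S (S (2 * n)) - S (2 * n)) with 1 by lia|].
      intro k; destruct (k - S (2 * n)); auto.
- intros e he; exists (element (currying e)); split.
  + apply (P_closed he he); intros; unfold element, currying, element, slice.
    computable.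
  + intro x; exists (element (slice e x)); split.
    * apply element_app; [apply currying_finitary|]; intro q; unfold currying; split.
      -- exists (size (tail q)); now rewrite Nat.sub_diag.
      -- intro k; destruct (size (tail q) - k); auto.
    * intros y z h; apply element_app; [apply slice_finitary|].
      intro n; split; [|now apply approx_sound].
      destruct (approx_complete h n) as [m hm]; exists m; now apply hm.
(* One value suffices: entry 0 of a pair is entry 0 of its tag. *)
- intros a b ha hb; exists (element (fun n k x => match k with 0 => 0 | S _ =>
    match x 0 with 0 => S (a n) | S _ => S (b n) end end)); split.
  + apply (P_closed ha hb); intros; unfold element; computable.
  + split; intro x; apply element_app;
      try (intros n [|k] y y' h; [reflexivity|now rewrite h by lia]);
      (intro n; split; [now exists 1|intros [|k]; auto]).
Qed.

End Baire.

Lemma K2_combinatory : combinatory K2.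
Proof. apply baire_combinatory; auto. Qed.

Lemma KV_combinatory : combinatory KV.
Proof. apply baire_combinatory; [apply computable_const|auto]. Qed.

Lemma algebra_of_combinatory (a : algebra_name) : combinatory (algebra_of a).
Proof.
destruct a; [apply K1_combinatory|apply K2_combinatory|apply KV_combinatory].
Qed.

Theorem corollary5p32 (a : algebra_name) :
  heyting_algebra (degree_le (@pW_le (algebra_of a))) /\
  order_isomorphic (degree_le (@pW_le (algebra_of a)))
                   (degree_le (@r_le (algebra_of a))).
Proof.
assert (HN := algebra_of_combinatory a).
assert (f_le := operation_of_le HN).
assert (fg := operation_of_multimap_of HN).
assert (hT := r_le_preheyting HN).
assert (hS := preheyting_transport f_le fg hT).
split; [exact (degree_heyting hS)|].
exact (degrees_isomorphic f_le fg (proj1 hS) (proj1 hT)).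
Qed.
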